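(* Let $V$ be an $n$-dimensional complex vector space with isotropic quadric $Q\subset\mathbb{P}(V)$, and let $k\geq1$. The normalized symmetric Kalman variety \[ \kappa^{nor}_{n,k}:=\overline{\{[T]\in\mathbb{P}(V^{\otimes k})\mid T\text{ has a singular vector }k\text{-tuple }([\mathbf{x}],\ldots,[\mathbf{x}])\text{ for some }[\mathbf{x}]\in\mathbb{P}(V)\setminus Q\}} \] is irreducible of codimension $(k-1)(n-1)$ in $\mathbb{P}(V^{\otimes k})$.
   Context: $q$ is a quadratic form on $V$, the complexification of a positive definite real quadratic form on a real form of $V$; $q(\cdot,\cdot)$ also denotes the associated complex symmetric bilinear form, and $Q=\{q=0\}\subset\mathbb{P}(V)$. Let $q_F$ be the induced bilinear form on $V^{\otimes k}$ with $q_F(\mathbf{x}_1\otimes\cdots\otimes\mathbf{x}_k,\mathbf{y}_1\otimes\cdots\otimes\mathbf{y}_k)=\prod_iq(\mathbf{x}_i,\mathbf{y}_i)$. For $T\in V^{\otimes k}$, a tuple $([\mathbf{x}_1],\ldots,[\mathbf{x}_k])\in\mathbb{P}(V)^{\times k}$ is a singular vector $k$-tuple of $T$ if for every $i$ the vector $\mathbf{v}_i\in V$ defined by $q(\mathbf{v}_i,\mathbf{y})=q_F(T,\mathbf{x}_1\otimes\cdots\otimes\mathbf{x}_{i-1}\otimes\mathbf{y}\otimes\mathbf{x}_{i+1}\otimes\cdots\otimes\mathbf{x}_k)$ for all $\mathbf{y}\in V$ is linearly dependent with $\mathbf{x}_i$. Closures are Zariski closures. *)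

(* Defs.v *)
From HB Require Import structures.
From mathcomp Require Import all_boot all_order all_algebra.
From mathcomp Require Import boolp classical_sets reals topology_structure.
From mathcomp Require Import complex.
From mathcomp Require Import mpoly.

Set Implicit Arguments.
Unset Strict Implicit.
Unset Printing Implicit Defensive.

Import Order.TTheory GRing.Theory Num.Theory.

Local Open Scope classical_set_scope.
Local Open Scope complex_scope.
Local Open Scope ring_scope.

Section Projective.
Variables (K : fieldType) (V : vectType K).

Definition proj : Type := {L : {vspace V} | \dim L == 1%N}.

HB.instance Definition _ := Choice.on proj.

Definition line (P : proj) : {vspace V} := val P.

(* Polynomial functions on V, in the coordinates of a fixed basis. A change of
   basis is an invertible linear substitution, so the Zariski topology below
   does not depend on it. *)
Definition polyfun (f : {mpoly K[\dim {:V}]}) (v : V) : K :=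
  f.@[fun i => coord (vbasis {:V}) i v].

Definition homogeneous (f : {mpoly K[\dim {:V}]}) : Prop :=
  exists d : nat, f \is d.-homog.

Definition zero_locus (S : set {mpoly K[\dim {:V}]}) : set proj :=
  [set P | forall f, S f -> forall v, v \in line P -> polyfun f v = 0].

Definition zariski_open (U : set proj) : Prop :=
  exists2 S : set {mpoly K[\dim {:V}]},
    S `<=` homogeneous & U = ~` zero_locus S.

Lemma polyfunZ d f c v : f \is d.-homog ->
  polyfun f (c *: v) = c ^+ d * polyfun f v.
Proof.
move=> /dhomogP hf; rewrite /polyfun !mevalE mulr_sumr.
rewrite !big_seq; apply: eq_bigr => m /hf dm.
rewrite [RHS]mulrCA; congr (_ * _).
under eq_bigr do rewrite linearZ /= exprMn.
rewrite big_split /= prodrXr -dm; congr (_ ^+ _ * _).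
exact/esym/mdegE.
Qed.

Lemma line_vpick (P : proj) v :
  v \in line P -> exists c, v = c *: vpick (line P).
Proof.
have dimP : \dim (line P) = 1%N by apply/eqP; exact: (svalP P).
suff {1}-> : line P = <[vpick (line P)]>%VS by move/vlineP.
apply/esym/eqP; rewrite eqEdim -memvE memv_pick dimP dim_vline vpick0.
by rewrite -dimv_eq0 dimP.
Qed.

Lemma polyfun_line (f : {mpoly K[\dim {:V}]}) (P : proj) :
  homogeneous f -> polyfun f (vpick (line P)) = 0 ->
  forall v, v \in line P -> polyfun f v = 0.
Proof.
by move=> [d df] f0 v /line_vpick[c ->]; rewrite (polyfunZ _ _ df) f0 mulr0.
Qed.

Lemma zariski_openT : zariski_open [set: proj].
Proof.
exists [set 1]; first by move=> _ ->; exists 0%N; exact: dhomog1.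
apply/seteqP; split=> // P _ /= /(_ 1 erefl 0 (mem0v _)).
by rewrite /polyfun meval1 => /eqP; rewrite oner_eq0.
Qed.

Lemma zariski_openI : setI_closed zariski_open.
Proof.
move=> _ _ [S hS ->] [S' hS' ->].
exists [set h | exists f g, [/\ S f, S' g & h = f * g]].
  move=> _ [f [g [/hS [d df] /hS' [e eg] ->]]].
  by exists (d + e)%N; exact: dhomogM.
rewrite -setCU; congr (~` _); apply/seteqP; split=> P /=.
  move=> hP _ [f [g [Sf Sg ->]]] v vP; rewrite /polyfun mevalM.
  by case: hP => [/(_ _ Sf _ vP)|/(_ _ Sg _ vP)];
    rewrite /polyfun => ->; rewrite ?mul0r ?mulr0.
move=> hP; apply: contrapT => /not_orP [nS nS']; apply: nS => f Sf.
apply: polyfun_line (hS _ Sf) _; apply: contrapT => /eqP f0.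
apply: nS' => g Sg; apply: polyfun_line (hS' _ Sg) _.
have fgP : exists f0 g0, [/\ S f0, S' g0 & f * g = f0 * g0] by exists f, g.
have := hP _ fgP _ (memv_pick _).
rewrite /polyfun mevalM => /eqP; rewrite mulf_eq0 -/(polyfun f _).
by rewrite (negPf f0) => /eqP.
Qed.

Lemma zariski_open_bigcup (I : Type) (F : I -> set proj) :
  (forall i, zariski_open (F i)) -> zariski_open (\bigcup_i F i).
Proof.
move=> /(_ _)/cid2-/all_sig2[S hS FE].
exists (\bigcup_i S i); first by move=> f [i _ /hS].
rewrite (eq_bigcupr (fun i _ => FE i)) -setC_bigcap; congr (~` _).
apply/seteqP; split=> P /= hP; first by move=> f [i iI Sf]; exact: (hP i iI f Sf).
by move=> i _ f Sf; apply: hP; exists i.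
Qed.

(* Hence [closed] and [closure] on [proj V] are meant in the Zariski sense. *)
HB.instance Definition _ := isOpenTopological.Build proj
  zariski_openT zariski_openI zariski_open_bigcup.

End Projective.
Arguments proj {K} V.

Definition irreducible (T : topologicalType) (A : set T) : Prop :=
  A !=set0 /\
  forall F G : set T, closed F -> closed G ->
    A `<=` F `|` G -> A `<=` F \/ A `<=` G.

Definition irreducible_chain (T : topologicalType) (A : set T) (c : nat)
    (Z : nat -> set T) : Prop :=
  [/\ Z 0%N = A,
      forall i, (i <= c)%N -> closed (Z i) /\ irreducible (Z i)
    & forall i, (i < c)%N -> Z i `<` Z i.+1].

(* The Krull codimension of an irreducible closed set: the supremum of the
   lengths of the chains A = Z_0 < Z_1 < ... < Z_c of irreducible closed
   sets. *)
Definition has_codim (T : topologicalType) (A : set T) (c : nat) : Prop :=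
  (exists Z, irreducible_chain A c Z) /\
  (forall m Z, irreducible_chain A m Z -> (m <= c)%N).

Section Tensor.
Variables (K : fieldType) (V : vectType K) (k : nat).

Definition multilinear (W : vectType K) (f : ('I_k -> V) -> W) : Prop :=
  forall (i : 'I_k) (x : 'I_k -> V), linear (fun y => f [eta x with i |-> y]).

(* (W, tens) is a k-th tensor power of V: tens is the universal multilinear
   map, x |-> x_1 (x) ... (x) x_k. *)
Definition tensor_power (W : vectType K) (tens : ('I_k -> V) -> W) : Prop :=
  multilinear tens /\
  forall (U : vectType K) (f : ('I_k -> V) -> U), multilinear f ->
    exists! g : 'Hom(W, U), forall x, g (tens x) = f x.

Definition induced_form (W : vectType K) (tens : ('I_k -> V) -> W)
    (q : {biscalar V}) (qF : {biscalar W}) : Prop :=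
  forall x y : 'I_k -> V, qF (tens x) (tens y) = \prod_i q (x i) (y i).

(* Neither existential is a real choice: the representatives x_i are unique up
   to nonzero scalars, and v is unique when q is nondegenerate. *)
Definition singular_tuple (W : vectType K) (tens : ('I_k -> V) -> W)
    (q : {biscalar V}) (qF : {biscalar W}) (T : W) (X : 'I_k -> proj V) : Prop :=
  exists2 x : 'I_k -> V, forall i, line (X i) = <[x i]>%VS &
    forall i, exists2 v : V,
      forall y, q v y = qF T (tens [eta x with i |-> y]) &
      ~~ free [:: v; x i].

Definition isotropic_quadric (q : {biscalar V}) : set (proj V) :=
  [set P | forall x, x \in line P -> q x x = 0].

Definition kalman_nor (W : vectType K) (tens : ('I_k -> V) -> W)
    (q : {biscalar V}) (qF : {biscalar W}) : set (proj W) :=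
  closure [set P | exists2 T : W, line P = <[T]>%VS &
    exists2 X : proj V, (~` isotropic_quadric q) X &
      singular_tuple tens q qF T (fun=> X)].

End Tensor.

Section RealForm.
Variables (R : realType) (V : vectType R[i]).

(* S is a real subspace of V with V = S (+) iS. *)
Definition real_form (S : set V) : Prop :=
  [/\ S 0,
      forall (r : R) x y, S x -> S y -> S (r%:C *: x + y),
      forall v, exists x y, [/\ S x, S y & v = x + 'i *: y]
    & forall x, S x -> S ('i *: x) -> x = 0].

(* A complex symmetric bilinear form is determined by its restriction to a
   real form S, so it is the complexification of that restriction as soon as
   the latter is real-valued. *)
Definition complexified_positive_definite (q : {biscalar V}) : Prop :=
  (forall x y, q x y = q y x) /\
  exists2 S : set V, real_form S &
    (forall x y, S x -> S y -> q x y \is Num.real) /\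
    (forall x, S x -> x != 0 -> 0 < q x x).

End RealForm.

(* Main.v *)
(* A singular tuple ([x], ..., [x]) with [x] not isotropic imposes k (n - 1)
   linear conditions on T, and x ranges over an (n - 1)-dimensional family.
   Moving x to a fixed e_0 by reflections s_w, with w in the affine chart
   e_0 + e_0^perp, parametrizes the set polynomially by
   n^k - (k - 1)(n - 1) parameters; this gives irreducibility.

   A chain of length (k - 1)(n - 1) is obtained by taking joins with points
   outside of the current variety: each join costs one parameter, and counting
   monomials shows that a polynomial map cannot be dominant before the number
   of parameters reaches n^k.

   No chain is longer: a strict inclusion of irreducible closed sets increases
   the number of algebraically independent functions, there are at most n^k of
   them on the whole space, and n^k - (k - 1)(n - 1) suitable coordinates of T
   are independent on the Kalman variety because the parametrization is, up to
   nonzero factors, the identity to first order at e_0 (x) ... (x) e_0. *)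

Require Import Defs.
From HB Require Import structures.
From mathcomp Require Import all_boot all_order all_algebra.
From mathcomp Require Import boolp classical_sets reals topology_structure.
From mathcomp Require Import complex mpoly ring.

Set Implicit Arguments.
Unset Strict Implicit.
Unset Printing Implicit Defensive.

Import Order.TTheory GRing.Theory Num.Theory.

Local Open Scope classical_set_scope.
Local Open Scope complex_scope.
Local Open Scope ring_scope.

(** * Polynomial functions along lines *)

Section LinePolynomial.
Variable K : numFieldType.

Lemma poly_eq0_horner (p : {poly K}) : (forall t, p.[t] = 0) -> p = 0.
Proof.
move=> p0; apply/eqP; apply: contraT => pN0.
pose s := [seq i%:R : K | i <- iota 0 (size p)].
have us : uniq s by rewrite map_inj_uniq ?iota_uniq // => i j /eqP; rewrite eqr_nat => /eqP.
have := max_poly_roots pN0 _ us; rewrite size_map size_iota ltnn; apply.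
by apply/allP => x _; apply/rootP.
Qed.

(** Polynomiality is tested along lines only, so no basis of [A] is needed and linear substitutions
    preserve it. The degree bound, uniform over all lines, is what interpolation on a finite grid
    needs. *)
Definition linepoly (A : lmodType K) (D : nat) (h : A -> K) :=
  forall a b, exists2 p : {poly K}, (size p <= D.+1)%N &
    forall t, h (a + t *: b) = p.[t].

Definition polymap (A : lmodType K) (h : A -> K) := exists D, linepoly D h.

Section Closure.
Variable A : lmodType K.
Implicit Types h g : A -> K.

Lemma linepoly_le D D' h : (D <= D')%N -> linepoly D h -> linepoly D' h.
Proof.
by move=> DD hp a b; have [p sp ph] := hp a b; exists p => //; apply: leq_trans sp _.
Qed.

Lemma linepoly_ext D h g : h =1 g -> linepoly D h -> linepoly D g.
Proof. by move=> /funext ->. Qed.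

Lemma linepolyC D c : linepoly D (fun _ : A => c).
Proof.
move=> a b; exists c%:P; last by move=> t; rewrite hornerC.
by rewrite (leq_trans (size_polyC_leq1 _)).
Qed.

Lemma linepolyD D h g : linepoly D h -> linepoly D g ->
  linepoly D (fun a => h a + g a).
Proof.
move=> hp gp a b; have [p sp ph] := hp a b; have [r sr rg] := gp a b.
exists (p + r); first by rewrite (leq_trans (size_polyD _ _)) // geq_max sp.
by move=> t; rewrite ph rg hornerD.
Qed.

Lemma linepolyM D E h g : linepoly D h -> linepoly E g ->
  linepoly (D + E) (fun a => h a * g a).
Proof.
move=> hp gp a b; have [p sp ph] := hp a b; have [r sr rg] := gp a b.
exists (p * r); last by move=> t; rewrite ph rg hornerM.
rewrite (leq_trans (size_polyMleq _ _)) // -subn1 leq_subLR add1n.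
by rewrite (leq_trans (leq_add sp sr)) // addSn addnS.
Qed.

Lemma linepoly_sum (I : Type) (r : seq I) (P : pred I) D (h : I -> A -> K) :
  (forall i, P i -> linepoly D (h i)) -> linepoly D (fun a => \sum_(i <- r | P i) h i a).
Proof.
move=> hp; elim: r => [|i r IH].
  by apply: linepoly_ext (linepolyC D 0) => a; rewrite big_nil.
have [Pi|nPi] := boolP (P i); last first.
  by apply: linepoly_ext IH => a; rewrite big_cons (negPf nPi).
by apply: linepoly_ext (linepolyD (hp i Pi) IH) => a; rewrite big_cons Pi.
Qed.

Lemma linepolyX D n h : linepoly D h -> linepoly (n * D) (fun a => h a ^+ n).
Proof.
move=> hp; elim: n => [|n IH]; first exact: linepoly_ext (linepolyC 0 1).
by apply: linepoly_ext (linepolyM hp IH) => a; rewrite exprS.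
Qed.

Lemma linepoly_prod (I : Type) (r : seq I) D (h : I -> A -> K) :
  (forall i, linepoly D (h i)) -> linepoly (size r * D) (fun a => \prod_(i <- r) h i a).
Proof.
move=> hp; elim: r => [|i r IH].
  by apply: linepoly_ext (linepolyC 0 1) => a; rewrite big_nil.
by apply: linepoly_ext (linepolyM (hp i) IH) => a; rewrite big_cons.
Qed.

Lemma polymapC c : polymap (fun _ : A => c).
Proof. by exists 0%N; exact: linepolyC. Qed.

Lemma polymapD h g : polymap h -> polymap g -> polymap (fun a => h a + g a).
Proof.
move=> [D hD] [E gE]; exists (D + E)%N; apply: linepolyD.
  by apply: linepoly_le hD; exact: leq_addr.
by apply: linepoly_le gE; exact: leq_addl.
Qed.

Lemma polymapM h g : polymap h -> polymap g -> polymap (fun a => h a * g a).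
Proof. by move=> [D hD] [E gE]; exists (D + E)%N; exact: linepolyM. Qed.

Lemma polymap_ext h g : h =1 g -> polymap h -> polymap g.
Proof. by move=> /funext ->. Qed.

Lemma polymap_sum (I : Type) (r : seq I) (P : pred I) (h : I -> A -> K) :
  (forall i, polymap (h i)) -> polymap (fun a => \sum_(i <- r | P i) h i a).
Proof.
move=> hp; elim: r => [|i r IH].
  by apply: polymap_ext (polymapC 0) => a; rewrite big_nil.
have [Pi|nPi] := boolP (P i); last first.
  by apply: polymap_ext IH => a; rewrite big_cons (negPf nPi).
by apply: polymap_ext (polymapD (hp i) IH) => a; rewrite big_cons Pi.
Qed.

Lemma polymap_prod (I : Type) (r : seq I) (h : I -> A -> K) :
  (forall i, polymap (h i)) -> polymap (fun a => \prod_(i <- r) h i a).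
Proof.
move=> hp; elim: r => [|i r IH].
  by apply: polymap_ext (polymapC 1) => a; rewrite big_nil.
by apply: polymap_ext (polymapM (hp i) IH) => a; rewrite big_cons.
Qed.

Lemma polymapX n h : polymap h -> polymap (fun a => h a ^+ n).
Proof. by move=> [D hD]; exists (n * D)%N; exact: linepolyX. Qed.

Lemma polymap_linear h : linear_for *%R h -> polymap h.
Proof.
move=> hlin; exists 1%N => a b; exists ((h a)%:P + h b *: 'X).
  rewrite (leq_trans (size_polyD _ _)) // geq_max (leq_trans (size_polyC_leq1 _)) //=.
  by rewrite (leq_trans (size_scale_leq _ _)) // size_polyX.
by move=> t; rewrite addrC hlin !hornerE addrC mulrC.
Qed.

Lemma polymap_meval m (f : {mpoly K[m]}) (h : 'I_m -> A -> K) :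
  (forall i, polymap (h i)) -> polymap (fun a => f.@[fun i => h i a]).
Proof.
move=> hp; have /polymap_ext : (fun a => \sum_(x <- msupp f) f@_x * \prod_i h i a ^+ x i)
   =1 (fun a => f.@[fun i => h i a]) by move=> a; rewrite mevalE.
apply; apply: polymap_sum => x; apply: polymapM; first exact: polymapC.
by apply: polymap_prod => i; apply: polymapX.
Qed.

Lemma polymap_uniform m (h : 'I_m -> A -> K) : (forall i, polymap (h i)) ->
  exists D, forall i, linepoly D (h i).
Proof.
move=> /choice[D hD]; exists (\max_i D i)%N => i.
by apply: linepoly_le (hD i); exact: leq_bigmax.
Qed.

(* Both functions restrict to nonzero polynomials on the line through [a] and [b]. *)
Lemma polymap_neq0M h g a b : polymap h -> polymap g -> h a != 0 -> g b != 0 ->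
  exists c, (h c != 0) && (g c != 0).
Proof.
move=> [D hD] [E gE] ha gb.
have [p _ ph] := hD a (b - a); have [r _ rg] := gE a (b - a).
have p0 : p != 0.
  by apply: contraNneq ha => p0; rewrite -[a]addr0 -(scale0r (b - a)) ph p0 horner0.
have r0 : r != 0.
  apply: contraNneq gb => r0; have := rg 1.
  by rewrite scale1r addrC subrK r0 horner0 => ->.
have [t prt] : exists t, (p * r).[t] != 0.
  apply: contrapT => /forallNP pr; have /eqP := mulf_neq0 p0 r0; apply.
  by apply: poly_eq0_horner => t; apply/eqP; rewrite -[_ == _]negbK; apply/negP/pr.
by exists (a + t *: (b - a)); rewrite ph rg -negb_or -mulf_eq0 -hornerM.
Qed.

End Closure.

Lemma polymap_comp (A B : lmodType K) (h : A -> K) (u : B -> A) :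
  linear u -> polymap h -> polymap (fun b => h (u b)).
Proof.
move=> ulin [D hD]; exists D => a b; have [p sp ph] := hD (u a) (u b).
by exists p => // t; rewrite addrC ulin addrC ph.
Qed.

(** * Vanishing on a finite grid *)

Section Grid.
Variable A : vectType K.
Local Notation M := (\dim {:A}).
Local Notation bs := (vbasis {:A}).

(** Coordinates leave the grid one at a time: along a coordinate direction [h] has degree at most
    [D] and vanishes at [D.+1] points. *)
Lemma linepoly_grid D (h : A -> K) : linepoly D h ->
  (forall g : {ffun 'I_M -> 'I_D.+1}, h (\sum_i (g i)%:R *: bs`_i) = 0) ->
  forall a, h a = 0.
Proof.
move=> hD h0.
(* Coordinates of index below [j] are arbitrary, the others still lie on the grid. *)
have main j : (j <= M)%N -> forall x : 'I_M -> K,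
    (forall i : 'I_M, (j <= i)%N -> exists g : 'I_D.+1, x i = g%:R) ->
    h (\sum_i x i *: bs`_i) = 0.
  elim: j => [|j IH] jM x xg.
    have [g gx] := choice (fun i => xg i isT).
    by rewrite -(h0 [ffun i => g i]); congr h; apply: eq_bigr => i _; rewrite gx ffunE.
  pose j0 := Ordinal jM.
  pose a := \sum_(i | i != j0) x i *: bs`_i.
  have [p sp ph] := hD a bs`_j0.
  have /eqP : p = 0.
    apply: (@roots_geq_poly_eq0 _ p [seq i%:R | i <- iota 0 D.+1]).
    - rewrite all_map; apply/allP => i; rewrite mem_iota add0n => /andP[_ iD].
      apply/rootP; rewrite -ph.
      pose y i' := if i' == j0 then i%:R else x i'.
      rewrite -(IH (ltnW jM) y); last first.
        move=> i'; rewrite leq_eqVlt /y => /predU1P[ji|ji].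
          have -> : i' = j0 by apply/val_inj.
          by rewrite eqxx; exists (Ordinal iD).
        by case: eqP => [i'j|_]; [rewrite i'j ltnn in ji|exact: xg].
      congr h; rewrite (bigD1 j0) //= /y eqxx addrC; congr (_ + _).
      by apply: eq_bigr => i' /negPf ->.
    - by rewrite map_inj_uniq ?iota_uniq // => u v /eqP; rewrite eqr_nat => /eqP.
    - by rewrite size_map size_iota.
  move=> /eqP p0; have := ph (x j0); rewrite p0 horner0 => <-.
  by congr h; rewrite (bigD1 j0) //= addrC.
move=> a; rewrite (coord_vbasis (memvf a)).
by apply: (main M) => // i; rewrite leqNgt ltn_ord.
Qed.

End Grid.

(** * Polynomials and their values *)

Section MpolyFunctions.

Lemma meval_muni m (x : 'I_m.+1 -> K) (p : {mpoly K[m.+1]}) :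
  p.@[x] = (map_poly (meval (fun i => x (widen_ord (leqnSn m) i))) (muni p)).[x ord_max].
Proof.
rewrite muniE rmorph_sum /= horner_sum mevalE; apply: eq_bigr => y _.
rewrite map_polyZ /= map_polyXn hornerZ hornerXn mevalZ mevalX -mulrA; congr (_ * _).
by rewrite big_ord_recr; congr (_ * _); apply: eq_bigr => i _; rewrite mnmE.
Qed.

Lemma mcoeff_muni m (p : {mpoly K[m.+1]}) (y : 'X_{1..m.+1}) :
  p@_y = ((muni p)`_(y ord_max))@_[multinom y (widen_ord (leqnSn m) i) | i < m].
Proof.
rewrite muniE coef_sum raddf_sum /= {1}[p]mpolyE raddf_sum /=.
apply: eq_bigr => x _; rewrite coefZ coefXn mcoeffZ mcoeffX.
case: (eqVneq x y) => [->|xy]; first by rewrite !eqxx !mulr1 mcoeffZ mcoeffX eqxx mulr1.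
case: eqP => [yx|_]; last by rewrite !mulr0 mcoeff0.
rewrite mulr1 mcoeffZ mcoeffX; congr (_ * _); case: eqP => // xyw.
case/eqP: xy; apply/mnmP => i; case: (unliftP ord_max i) => [j ->|-> //].
have -> : lift ord_max j = widen_ord (leqnSn m) j by apply/val_inj; exact: lift_max.
by move/mnmP: xyw => /(_ j); rewrite !mnmE.
Qed.

Lemma muni_eq0 m (p : {mpoly K[m.+1]}) : muni p = 0 -> p = 0.
Proof.
by move=> p0; apply/mpolyP => y; rewrite mcoeff_muni p0 coef0 !mcoeff0.
Qed.

(** Induction on the number of variables: with all but the last one fixed, [muni f] becomes a
    univariate polynomial without nonzero values, so its coefficients vanish at every point. *)
Lemma mpoly_eq0_meval m (f : {mpoly K[m]}) : (forall x, f.@[x] = 0) -> f = 0.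
Proof.
elim: m f => [|m IH] f f0.
  have := f0 (fun _ => 0); rewrite [f]nvar0_mpolyC mevalC => ->.
  exact: mpolyC0.
apply: muni_eq0; apply/polyP => j; rewrite coef0; apply: IH => x.
have /polyP/(_ j) : map_poly (meval x) (muni f) = 0.
  apply: poly_eq0_horner => t.
  rewrite -(f0 (fun i => oapp x t (unlift ord_max i))) meval_muni unlift_none /=.
  congr _.[_]; apply: eq_map_poly => g; apply: meval_eq => i.
  have -> : widen_ord (leqnSn m) i = lift ord_max i by apply/val_inj; exact/esym/lift_max.
  by rewrite liftK.
by rewrite coef_map coef0.
Qed.

Lemma meval_pihomog m d (f : {mpoly K[m]}) c x :
  (pihomog mdeg d f).@[fun i => c * x i] = c ^+ d * (pihomog mdeg d f).@[x].
Proof.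
have /dhomogP hf := pihomogP [measure of mdeg] d f.
rewrite !mevalE mulr_sumr !big_seq; apply: eq_bigr => y /hf yd.
rewrite [RHS]mulrCA; congr (_ * _).
under eq_bigr do rewrite exprMn.
by rewrite big_split /= prodrXr -yd; congr (_ ^+ _ * _); exact/esym/mdegE.
Qed.

Lemma meval_homogeneous_parts m (f : {mpoly K[m]}) c x :
  f.@[fun i => c * x i] =
  \sum_(d < msize f) c ^+ d * (pihomog mdeg d f).@[x].
Proof.
rewrite [f in LHS](pihomog_partitionE (leqnn (msize f))) raddf_sum /=.
by apply: eq_bigr => d _; rewrite meval_pihomog.
Qed.

End MpolyFunctions.

(** * Algebraic dependence by counting monomials *)

Section Dependency.
Variable A : vectType K.
Local Notation M := (\dim {:A}).

(** The right-hand side counts monomials with exponents below [B], the left-hand side the grid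
    points that detect their degree. The latter grows only like [B ^ m], with a constant factor that
    the chosen [B] exceeds. *)
Lemma box_outgrows_grid (m N e : nat) : (m < N)%N -> exists2 B,
  (0 < B)%N & ((N * (B * e)).+1 ^ m < B ^ N)%N.
Proof.
move=> mN; exists ((N * e).+1 ^ m).+1 => //.
set B := ((N * e).+1 ^ m).+1; apply: (@leq_ltn_trans ((B * (N * e).+1) ^ m)).
  move: B (isT : (0 < B)%N) => B B0; case: m {mN} => // m; rewrite leq_exp2r // mulnS (mulnCA N).
  by rewrite -[(_ * _).+1]add1n leq_add2r.
rewrite expnMn; apply: (@leq_trans (B ^ m.+1)); last by rewrite leq_pexp2l.
by rewrite expnSr ltn_pmul2l // expn_gt0.
Qed.

(** Combinations of monomials of bounded exponents in the [h i] are determined by their values on a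
    grid in [A]. There are more monomials than grid points, so a nontrivial combination vanishes on
    the grid, hence everywhere. *)
Lemma mpoly_dependency N (h : 'I_N -> A -> K) :
  (M < N)%N -> (forall i, polymap (h i)) ->
  exists2 f : {mpoly K[N]}, f != 0 & forall a, f.@[fun i => h i a] = 0.
Proof.
move=> MN /polymap_uniform[e he]; have [B B0 hB] := box_outgrows_grid e MN.
pose D := (N * (B * e))%N; pose G := {ffun 'I_M -> 'I_D.+1}.
pose E := {ffun 'I_N -> 'I_B}.
pose mon (c : E) a := \prod_i h i a ^+ c i.
pose pt (g : G) := \sum_i (g i)%:R *: (vbasis {:A})`_i.
pose Mx := \matrix_(c < #|E|, g < #|G|) mon (enum_val c) (pt (enum_val g)).
have : kermx Mx != 0.
  rewrite -mxrank_eq0 mxrank_ker subn_eq0 -ltnNge.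
  by rewrite (leq_ltn_trans (rank_leq_col _)) // !card_ffun !card_ord.
case/rowV0Pn => v /sub_kermxP vM v0.
pose mn (c : E) := [multinom (c i : nat) | i < N].
have mn_inj : injective mn.
  move=> c c' /mnmP cc; apply/ffunP => i; apply/val_inj.
  by have := cc i; rewrite !mnmE.
exists (\sum_(c < #|E|) v ord0 c *: 'X_[mn (enum_val c)]).
  apply: contraNneq v0 => f0; apply/eqP/rowP => c; rewrite mxE.
  have := congr1 (mcoeff (mn (enum_val c))) f0; rewrite mcoeff0 => <-.
  rewrite raddf_sum (bigD1 c) //= mcoeffZ mcoeffX eqxx mulr1 big1 ?addr0 // => c' c'c.
  rewrite mcoeffZ mcoeffX; case: eqP => [/mn_inj/enum_val_inj cc|_]; last by rewrite mulr0.
  by rewrite cc eqxx in c'c.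
have fE a : (\sum_(c < #|E|) v ord0 c *: 'X_[mn (enum_val c)]).@[fun i => h i a]
    = \sum_(c < #|E|) v ord0 c * mon (enum_val c) a.
  rewrite raddf_sum /=; apply: eq_bigr => c _; rewrite mevalZ mevalX.
  by congr (_ * _); apply: eq_bigr => i _; rewrite mnmE.
apply: (@linepoly_grid _ D).
  apply: (linepoly_ext (fun a => esym (fE a))); apply: linepoly_sum => c _.
  have := linepolyM (linepolyC 0 (v ord0 c)) _; apply.
  have : linepoly (size (index_enum 'I_N) * (B * e)) (mon (enum_val c)).
    apply: linepoly_prod => i; apply: linepoly_le (linepolyX _ (he i)).
    by rewrite leq_mul2r ltnW ?orbT.
  by rewrite /index_enum -enumT size_enum_ord.
move=> g; rewrite fE; have /rowP/(_ (enum_rank g)) := vM; rewrite !mxE => vg.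
by rewrite -[RHS]vg; apply: eq_bigr => c _; rewrite mxE enum_rankK.
Qed.

End Dependency.
End LinePolynomial.

(** * Parametrized varieties and their chains *)

Section Zariski.
Variables (K : numFieldType) (W : vectType K).
Implicit Types (f g : {mpoly K[\dim {:W}]}) (Z : set (proj W)).

Lemma polymap_polyfun f : polymap (polyfun f).
Proof.
apply: (@polymap_meval _ W _ f (fun i v => coord (vbasis {:W}) i v)) => i.
by apply: polymap_linear; exact: linearP.
Qed.

Lemma polymap_line f w : polymap (fun t : K^o => polyfun f (t *: w)).
Proof.
apply: (@polymap_comp _ W K^o (polyfun f) (fun t => t *: w)); last exact: polymap_polyfun.
by move=> c x y; rewrite scalerDl scalerA.
Qed.

Lemma closed_zero_locus S : S `<=` @homogeneous K W -> closed (zero_locus S).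
Proof.
move=> hS; rewrite -[zero_locus S]setCK; apply: open_closedC.
by exists S.
Qed.

Lemma closedP Z : closed Z ->
  exists2 S, S `<=` @homogeneous K W & Z = zero_locus S.
Proof.
move=> /closed_openC[S hS ZS]; exists S => //.
by rewrite -[LHS]setCK ZS setCK.
Qed.

(** At [t *: v] the value of [f] is a polynomial in [t] whose coefficients are the values at [v] of
    the homogeneous parts of [f]. Vanishing on a whole line thus means that all these parts vanish,
    a closed condition. *)
Lemma closed_polyfun_vanish f :
  closed [set P : proj W | forall v, v \in line P -> polyfun f v = 0].
Proof.
pose S := [set pihomog mdeg d f | d in [set: nat]].
suff -> : [set P : proj W | forall v, v \in line P -> polyfun f v = 0] = zero_locus S.
  by apply: closed_zero_locus => _ [d _ <-]; exists d; exact: pihomogP.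
apply/seteqP; split=> P /= hP.
  move=> _ [d _ <-] v vP.
  have part0 : forall t, \sum_(i < msize f) t ^+ i * polyfun (pihomog mdeg i f) v = 0.
    move=> t; rewrite -(meval_homogeneous_parts f).
    rewrite -[RHS](hP (t *: v)) ?memvZ //.
    by apply: meval_eq => i; rewrite linearZ.
  pose p := \poly_(i < msize f) polyfun (pihomog mdeg i f) v.
  have p0 : p = 0.
    apply: poly_eq0_horner => t; rewrite horner_poly -[RHS](part0 t).
    by apply: eq_bigr => i _; rewrite mulrC.
  have [df|fd] := ltnP d (msize f).
    by have /polyP/(_ d) := p0; rewrite coef_poly df coef0.
  rewrite [f](pihomog_partitionE (leqnn (msize f))) raddf_sum /= /polyfun raddf_sum big1 //= => i _.
  rewrite (pihomog_ne0 _ (pihomogP _ i f)) ?meval0 //.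
  by rewrite neq_ltn (leq_trans (ltn_ord i) fd).
move=> v vP; rewrite /polyfun.
have -> : f.@[fun i => coord (vbasis {:W}) i v] = f.@[fun i => 1 * coord (vbasis {:W}) i v].
  by apply: meval_eq => i; rewrite mul1r.
rewrite meval_homogeneous_parts big1 // => d _; rewrite [X in _ * X](hP _ _ v) ?mulr0 //.
by exists (d : nat).
Qed.

Definition pline (v : W) (v0 : v != 0) : proj W :=
  exist (fun L : {vspace W} => \dim L == 1%N) <[v]>%VS
    (introT eqP (etrans (dim_vline v) (congr1 nat_of_bool v0))).

Lemma line_pline v (v0 : v != 0) : line (pline v0) = <[v]>%VS.
Proof. by []. Qed.

Lemma line_nz (P : proj W) (v : W) : line P = <[v]>%VS -> v != 0.
Proof.
move=> Pv; have /eqP := svalP P; rewrite -[sval P]/(line P) Pv dim_vline.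
by case: eqP.
Qed.

Lemma line_gen (P : proj W) : exists v, line P = <[v]>%VS.
Proof.
exists (vpick (line P)); have dimP : \dim (line P) = 1%N by apply/eqP; exact: (svalP P).
apply/esym/eqP; rewrite eqEdim -memvE memv_pick dimP dim_vline vpick0.
by rewrite -dimv_eq0 dimP.
Qed.

Lemma polyfun_surj (x : 'I_(\dim {:W}) -> K) :
  exists v, (fun i => coord (vbasis {:W}) i v) = x.
Proof.
exists (\sum_i x i *: (vbasis {:W})`_i); apply/funext => i.
rewrite linear_sum (bigD1 i) //= linearZ /= coord_free ?(basis_free (vbasisP _)) //.
rewrite eqxx mulr1 big1 ?addr0 // => j ji.
rewrite linearZ /= coord_free ?(basis_free (vbasisP _)) //.
by case: eqP => [ij|_]; [rewrite ij eqxx in ji|rewrite mulr0].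
Qed.

Lemma polyfun_eq0 f : (forall v, polyfun f v = 0) -> f = 0.
Proof.
move=> f0; apply: mpoly_eq0_meval => x; have [v <-] := polyfun_surj x; exact: f0.
Qed.

(* On each line of [Z] one of the factors vanishes identically, so [Z] is covered
   by two closed sets. *)
Lemma irreducible_vanishM Z f g : irreducible Z ->
  (forall P v, Z P -> v \in line P -> polyfun f v * polyfun g v = 0) ->
  (forall P v, Z P -> v \in line P -> polyfun f v = 0) \/
  (forall P v, Z P -> v \in line P -> polyfun g v = 0).
Proof.
move=> [_ Zirr] fg0.
suff : Z `<=` [set P : proj W | forall v, v \in line P -> polyfun f v = 0]
  `|` [set P : proj W | forall v, v \in line P -> polyfun g v = 0].
  case/(Zirr _ _ (@closed_polyfun_vanish f) (@closed_polyfun_vanish g)) => h;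
    by [left => P v /h; apply|right => P v /h; apply].
move=> P ZP; apply: contrapT => /not_orP[/existsNP[u /not_implyP[uP /eqP fu]]].
move=> /existsNP[v /not_implyP[vP /eqP gv]].
have [w0 Pw] := line_gen P; move: uP vP; rewrite Pw => /vlineP[a ua] /vlineP[b vb].
rewrite ua in fu; rewrite vb in gv.
have [c /andP[fc gc]] := polymap_neq0M (polymap_line f w0) (polymap_line g w0) fu gv.
have cP : c *: w0 \in line P by rewrite Pw memvZ // memv_line.
by have /eqP := fg0 P _ ZP cP; rewrite mulf_eq0 (negPf fc) (negPf gc).
Qed.

(** Parameters with [h a = 0] contribute no point, since [line P] has dimension one. *)
Definition image_closure (A : vectType K) (h : A -> W) (dl : A -> K) : set (proj W) :=
  closure [set P | exists2 a, dl a != 0 & line P = <[h a]>%VS].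

Section Parametrized.
Variables (A : vectType K) (h : A -> W) (dl : A -> K).
Hypothesis h_poly : forall i, polymap (fun a => coord (vbasis {:W}) i (h a)).
Hypothesis dl_poly : polymap dl.

Lemma polymap_polyfun_param f : polymap (fun a => polyfun f (h a)).
Proof. exact: (@polymap_meval _ A _ f (fun i a => coord (vbasis {:W}) i (h a))). Qed.

(** Two closed sets not containing the closure are each avoided by some allowed parameter. Products
    of nonzero polynomial functions are nonzero, so a single parameter avoids both. *)
Lemma irreducible_image_closure : (exists2 a, dl a != 0 & h a != 0) ->
  irreducible (image_closure h dl).
Proof.
move=> [a0 dla0 ha0]; split.
  by exists (pline ha0); apply: subset_closure; exists a0.
move=> F G Fcl Gcl FG.
have [S Sh FE] := closedP Fcl; have [S' Sh' GE] := closedP Gcl.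
apply: contrapT => /not_orP[nF nG].
have wit S0 : S0 `<=` @homogeneous K W -> ~ image_closure h dl `<=` zero_locus S0 ->
    exists2 f, S0 f & exists2 a, dl a != 0 & polyfun f (h a) != 0.
  move=> S0h; apply: contra_notP => nwit P; rewrite /image_closure => Pc.
  rewrite closureE in Pc; apply: Pc; split; first exact: closed_zero_locus.
  move=> {}P [a dla Pa] f S0f v; rewrite Pa => /vlineP[c ->].
  have [d df] := S0h _ S0f; rewrite (polyfunZ _ _ df).
  suff -> : polyfun f (h a) = 0 by rewrite mulr0.
  apply: contrapT => /eqP fa; apply: nwit; exists f => //; by exists a.
rewrite FE in nF; rewrite GE in nG.
have [f Sf [a dla fa]] := wit _ Sh nF; have [g Sg [b dlb gb]] := wit _ Sh' nG.
(* A nonzero coordinate of [h] joins the product, so that the common parameter gives a projective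
   point. *)
have [i hi] : exists i, coord (vbasis {:W}) i (h a0) != 0.
  apply: contrapT => /forallNP all0; case/eqP: ha0.
  rewrite (coord_vbasis (memvf (h a0))) big1 // => i _.
  by have /negP := all0 i; rewrite negbK => /eqP ->; rewrite scale0r.
have [c1 /andP[fc1 gc1]] :=
  polymap_neq0M (polymap_polyfun_param f) (polymap_polyfun_param g) fa gb.
have fg1 : polyfun f (h c1) * polyfun g (h c1) != 0 by rewrite mulf_neq0.
have [c2 /andP[fc2 dlc2]] := polymap_neq0M
  (polymapM (polymap_polyfun_param f) (polymap_polyfun_param g)) dl_poly fg1 dla.
have fgd2 : polyfun f (h c2) * polyfun g (h c2) * dl c2 != 0 by rewrite mulf_neq0.
have [c /andP[]] := polymap_neq0M (polymapM
  (polymapM (polymap_polyfun_param f) (polymap_polyfun_param g)) dl_poly) (h_poly i) fgd2 hi.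
rewrite !mulf_eq0 !negb_or => /andP[/andP[fc gc] dlc] hic.
have hc : h c != 0 by apply: contraNneq hic => ->; rewrite linear0.
have : (F `|` G) (pline hc) by apply/FG/subset_closure; exists c.
rewrite FE GE => -[/(_ f Sf (h c))|/(_ g Sg (h c))]; rewrite line_pline memv_line.
  by move=> /(_ isT)/eqP; rewrite (negPf fc).
by move=> /(_ isT)/eqP; rewrite (negPf gc).
Qed.

(** With too few parameters the coordinates of [h] satisfy a relation [f], perhaps inhomogeneous.
    Stability of the image under scaling makes [f] vanish on whole lines, so a dense image would
    force [f = 0]. *)
Lemma image_closure_neqT : (\dim {:A} < \dim {:W})%N ->
  (forall a c, dl a != 0 -> c != 0 -> exists2 a', dl a' != 0 & h a' = c *: h a) ->
  image_closure h dl <> setT.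
Proof.
move=> AW scal allT.
have [f f0 fh] := mpoly_dependency AW h_poly.
case/eqP: f0; apply: polyfun_eq0 => w.
have [P wP] : exists P : proj W, w \in line P.
  have [->|w0] := eqVneq w 0; last by exists (pline w0); rewrite line_pline memv_line.
  have v0 : vpick {:W} != 0 by rewrite vpick0 -dimv_eq0 -lt0n (leq_ltn_trans _ AW).
  by exists (pline v0); rewrite mem0v.
have : image_closure h dl P by rewrite allT.
rewrite /image_closure closureE => /(_ _ (conj (@closed_polyfun_vanish f) _)); apply => //.
move=> {wP}P [a dla Pa] v /=; rewrite Pa => /vlineP[c ->].
apply: contrapT => /eqP fc.
(* The scalar [c] may be zero, where [scal] does not apply; a nonzero value of [f] on the line also
   occurs at some [t != 0]. *)
have id_poly : polymap (fun t : K^o => t : K) by apply: polymap_linear => x y z.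
have [t /andP[ft t0]] := polymap_neq0M (polymap_line f (h a)) id_poly fc (oner_neq0 K).
have [a' dla' ha'] := scal a t dla t0.
by move: ft; rewrite -ha' /polyfun fh eqxx.
Qed.
End Parametrized.

(* Each step joins the image with one point outside of its closure. *)
Lemma image_closure_chain m (A : vectType K) (h : A -> W) (dl : A -> K) :
  (forall i, polymap (fun a => coord (vbasis {:W}) i (h a))) -> polymap dl ->
  (exists2 a, dl a != 0 & h a != 0) ->
  (forall a c, dl a != 0 -> c != 0 -> exists2 a', dl a' != 0 & h a' = c *: h a) ->
  (\dim {:A} + m <= \dim {:W})%N ->
  exists C, irreducible_chain (image_closure h dl) m C.
Proof.
elim: m A h dl => [|m IH] A h dl h_poly dl_poly nz scal dimA.
  exists (fun=> image_closure h dl); split=> // i _; split; first exact: closed_closure.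
  exact: irreducible_image_closure.
have AW : (\dim {:A} < \dim {:W})%N by rewrite (leq_trans _ dimA) // addnS ltnS leq_addr.
have /existsNP[P nP] : ~ forall P, image_closure h dl P.
  by move=> allT; apply: (image_closure_neqT h_poly AW scal); apply/seteqP; split.
have [w Pw] := line_gen P.
(* This [p] makes the parameter [(a, 1)] go to [w], while the parameters [(b, 0)] recover [h]. *)
have [a dla ha] := nz; pose p := w - h a.
pose h' (b : (A * K^o)%type) := h b.1 + b.2 *: p.
pose dl' (b : (A * K^o)%type) := dl b.1.
have sub : image_closure h dl `<` image_closure h' dl'.
  split.
    apply: closureS => P0 [b dlb Pb]; exists (b, 0) => //.
    by rewrite /h' scale0r addr0.
  move=> /(_ P) P'P; apply/nP/P'P/subset_closure; exists (a, 1) => //.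
  by rewrite /h' scale1r addrC subrK.
have [|||||C [C0 Cirr Cs]] := IH (A * K^o)%type h' dl'.
- move=> i; apply: (@polymap_ext _ _ (fun b : A * K^o =>
    coord (vbasis {:W}) i (h b.1) + b.2 * coord (vbasis {:W}) i p)).
    by move=> b; rewrite /h' [RHS]linearD linearZ.
  apply: polymapD; first by apply: (polymap_comp _ (h_poly i)).
  by apply: polymapM; [apply: polymap_linear|apply: polymapC].
- exact: (polymap_comp _ dl_poly).
- by exists (a, 0) => //; rewrite /h' scale0r addr0.
- move=> b c dlb c0; have [b1 dlb1 hb1] := scal b.1 c dlb c0.
  by exists (b1, c * b.2) => //; rewrite /h' /= hb1 [RHS]scalerDr [in RHS]scalerA.
- rewrite (leq_trans _ dimA) // !dimvf addnS -addSn leq_add2r.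
  by rewrite -addn1.
exists (fun i => if i is j.+1 then C j else image_closure h dl); split=> //.
  case=> [|i] im; last exact: Cirr.
  split; [exact: closed_closure|exact: irreducible_image_closure].
by case=> [|i] im; [rewrite C0|exact: Cs].
Qed.
End Zariski.

(** * Algebraic independence *)

Section AlgebraicIndependence.
Variables (K : numFieldType) (W : vectType K).
Local Notation R := {mpoly K[\dim {:W}]}.
Implicit Types (Z : set (proj W)).

(** The [f i] are taken on the affine cone over [Z], where inhomogeneous functions and relations
    make sense. *)
Definition algindep Z d (f : 'I_d -> R) := forall P : {mpoly K[d]},
  (forall L v, Z L -> v \in line L -> P.@[fun i => polyfun (f i) v] = 0) -> P = 0.

Lemma meval_comp d (f : 'I_d -> R) (P : {mpoly K[d]}) v :
  polyfun (P \mPo [tuple f i | i < d]) v = P.@[fun i => polyfun (f i) v].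
Proof.
by rewrite /polyfun comp_mpoly_meval; apply: meval_eq => i; rewrite tnth_mktuple.
Qed.

(* If [g] vanishes on [Z], the constant term in [g] of a relation between the [f i]
   and [g] restricts to a relation between the [f i] on [Z]. *)
Lemma algindep_step Z Z' d (f : 'I_d -> R) :
  closed Z -> irreducible Z' -> Z `<` Z' -> algindep Z f ->
  exists f' : 'I_d.+1 -> R, algindep Z' f'.
Proof.
move=> Zcl Z'irr [ZZ' nZ'Z] fZ; have [S hS ZE] := closedP Zcl.
have [g [L0 [v0 [Sg ZL0 v0L gv]]]] : exists g L v,
    [/\ S g, Z' L, v \in line L & polyfun g v <> 0].
  apply: contrapT => nog; apply: nZ'Z => L Z'L; rewrite ZE => g Sg v vL.
  by apply: contrapT => gv; apply: nog; exists g, L, v.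
exists (fun i => oapp f g (unlift ord_max i)) => P P0.
(* [P] is read as a polynomial in [g], its last variable, with coefficients in the [f i]. *)
pose ev v : {poly {mpoly K[d]}} -> {poly K} := map_poly (meval (fun i => polyfun (f i) v)).
have {P0} : forall L v, Z' L -> v \in line L -> (ev v (muni P)).[polyfun g v] = 0.
  move=> L v Z'L vL; rewrite -(P0 L v Z'L vL) meval_muni unlift_none /=.
  congr _.[_]; apply: eq_map_poly => h; apply: meval_eq => i.
  have -> : widen_ord (leqnSn d) i = lift ord_max i by apply/val_inj; exact/esym/lift_max.
  by rewrite liftK.
move=> evP; apply: muni_eq0; elim/poly_ind: (muni P) evP => // p c IH evp.
have evE v : (ev v (p * 'X + c%:P)).[polyfun g v] =
    (ev v p).[polyfun g v] * polyfun g v + c.@[fun i => polyfun (f i) v].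
  by rewrite /ev rmorphD rmorphM /= map_polyX map_polyC !hornerE.
have c0 : c = 0.
  apply: fZ => L v ZL vL; have := evp L v (ZZ' _ ZL) vL.
  by move: ZL; rewrite evE ZE => ->; rewrite // mulr0 add0r.
suff -> : p = 0 by rewrite c0 mul0r add0r polyC0.
apply: IH.
(* With [c] zero, the relation on [Z'] is [g] times the quotient [h], and [g] is not identically
   zero there. *)
pose h : R := \sum_(i < size p) (p`_i \mPo [tuple f j | j < d]) * g ^+ i.
have hE v : polyfun h v = (ev v p).[polyfun g v].
  rewrite /polyfun raddf_sum /= (@horner_coef_wide _ (size p)); last exact: size_poly.
  apply: eq_bigr => i _; rewrite mevalM rmorphXn /= coef_map /=; congr (_ * _).
  exact: (meval_comp f p`_i v).
have [] : _ \/ _ := @irreducible_vanishM _ _ Z' h g Z'irr _.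
- move=> L v Z'L vL; have := evp L v Z'L vL.
  by rewrite evE c0 meval0 addr0 hE.
- by move=> h0 L v Z'L vL; rewrite -hE (h0 L).
- by move=> /(_ L0 v0 ZL0 v0L).
Qed.

(** Each strict inclusion adds an independent function, and more than [\dim {:W}] polynomial
    functions on [W] always satisfy a relation. *)
Lemma chain_length m (C : nat -> set (proj W)) d (f : 'I_d -> R) Z :
  irreducible_chain Z m C -> algindep Z f -> (d + m <= \dim {:W})%N.
Proof.
move=> [C0 Cirr Cs] fZ.
have [f' f'indep] : exists f' : 'I_(d + m) -> R, algindep (C m) f'.
  have main j : (j <= m)%N -> exists f' : 'I_(d + j) -> R, algindep (C j) f'.
    elim: j => [|j IH] jm; first by rewrite addn0 C0; exists f.
    have [f' f'j] := IH (ltnW jm); rewrite addnS.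
    by apply: (algindep_step _ _ (Cs j jm) f'j); [apply Cirr; exact: ltnW|apply Cirr].
  exact: main.
rewrite leqNgt; apply/negP => dimW.
have [P P0 Pf] := mpoly_dependency dimW (fun i => polymap_polyfun (f' i)).
by case/eqP: P0; apply: f'indep => L v _ _; exact: Pf.
Qed.

(* Only the lowest homogeneous part of [P] survives at [t = 0]. *)
Lemma lowest_part d (P : {mpoly K[d]}) : P <> 0 ->
  exists2 Q : {mpoly K[d]}, Q <> 0 & forall (dl : {poly K}) (G : 'I_d -> {poly K}),
    dl != 0 -> (forall t, dl.[t] * P.@[fun i => t * (G i).[t]] = 0) ->
    Q.@[fun i => (G i).[0]] = 0.
Proof.
move=> P0.
pose part e := pihomog mdeg e P.
have exN : exists e, part e != 0.
  apply: contrapT => /forallNP all0; apply: P0.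
  rewrite (pihomog_partitionE (leqnn (msize P))) big1 // => i _.
  by have /negP := all0 i; rewrite negbK => /eqP.
exists (part (ex_minn exN)); case: ex_minnP => e e0 emin; first exact/eqP.
move=> dl G dl0 dlP.
pose p i : {poly K} := \sum_(y <- msupp (part i)) (part i)@_y *: \prod_j G j ^+ y j.
have pE i t : (p i).[t] = (part i).@[fun j => (G j).[t]].
  rewrite mevalE horner_sum; apply: eq_bigr => y _; rewrite hornerZ horner_prod.
  by congr (_ * _); apply: eq_bigr => j _; rewrite horner_exp.
have : \sum_(i < msize P) 'X^i * p i = 0.
  have : dl * (\sum_(i < msize P) 'X^i * p i) = 0.
    apply: poly_eq0_horner => t; rewrite hornerM -[RHS](dlP t) meval_homogeneous_parts.
    by rewrite horner_sum; congr (_ * _); apply: eq_bigr => i _; rewrite hornerM hornerXn pE.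
  by move/eqP; rewrite mulf_eq0 (negPf dl0) => /eqP.
have eP : (e < msize P)%N.
  rewrite ltnNge; apply: contraNN e0 => Pe.
  rewrite /part [P](pihomog_partitionE (leqnn (msize P))) raddf_sum big1 //= => i _.
  by rewrite (pihomog_ne0 _ (pihomogP _ i P)) // neq_ltn (leq_trans (ltn_ord i) Pe).
rewrite (bigD1 (Ordinal eP)) //= => sum0.
(* Parts above degree [e] carry a higher power of ['X], those below vanish by minimality of [e].
   Dividing by ['X^e] and evaluating at 0 isolates the part of degree [e]. *)
have /dvdpP[r rE] : dvdp 'X^(e.+1) (\sum_(i < msize P | i != Ordinal eP) 'X^i * p i).
  apply: (big_ind (dvdp 'X^(e.+1))); [exact: dvdp0|exact: dvdp_add|].
  move=> i ie; have [ei|ie'] := ltnP e i; first by rewrite dvdp_mulr // dvdp_exp2l.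
  rewrite [p i](_ : _ = 0) ?mulr0 ?dvdp0 //.
  have part0 : part i = 0.
    apply: contraTeq ie' => /emin; rewrite leq_eqVlt -ltnNge => /predU1P[ei|//].
    by case/eqP: ie; apply/val_inj.
  by apply: poly_eq0_horner => t; rewrite pE part0 meval0.
move: sum0; rewrite rE exprS mulrA mulrC -mulrDl => /eqP.
rewrite mulf_eq0 expf_eq0 polyX_eq0 andbF orbF => /eqP /(congr1 (horner^~ 0)).
by rewrite !hornerE pE.
Qed.
End AlgebraicIndependence.

(** * The Kalman variety in coordinates *)

Section Tensors.
Variables (K : numClosedFieldType) (V W : vectType K) (n k : nat).
Variables (q : {biscalar V}) (tens : ('I_k.+1 -> V) -> W) (qF : {biscalar W}).
Variable e : 'I_n.+1 -> V.
Hypothesis qC : forall x y, q x y = q y x.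
Hypothesis e_orth : forall a b, q (e a) (e b) = (a == b)%:R.
Hypothesis e_span : forall v, v = \sum_a q v (e a) *: e a.

Local Notation index := {ffun 'I_k.+1 -> 'I_n.+1}.
Implicit Types (T : W) (I J : index) (x y u v w : V).

Definition tens_basis I : W := tens (fun j => e (I j)).
Local Notation E := tens_basis.
Definition tau I T := qF T (E I).

Hypothesis E_span : forall T, T = \sum_I tau I T *: E I.
Hypothesis hqF : induced_form tens q qF.

Lemma qF_tens T (y : 'I_k.+1 -> V) :
  qF T (tens y) = \sum_I tau I T * \prod_j q (e (I j)) (y j).
Proof.
rewrite {1}[T]E_span linear_sumlz; apply: eq_bigr => I _.
by rewrite linearZl_LR /= hqF.
Qed.

Lemma tauE (c : index -> K) I : tau I (\sum_J c J *: E J) = c I.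
Proof.
rewrite /tau linear_sumlz (bigD1 I) //= linearZl_LR /= hqF big1 ?mulr1; last first.
  by move=> j _; rewrite e_orth eqxx.
rewrite big1 ?addr0 // => J JI; rewrite linearZl_LR /= hqF.
have [j Jj] : exists j, J j != I j.
  apply/existsP; apply: contraNT JI; rewrite negb_exists => /forallP JI.
  by apply/eqP/ffunP => j; apply/eqP; have := JI j; rewrite negbK.
by rewrite (bigD1 j) //= e_orth (negPf Jj) mul0r mulr0.
Qed.

Lemma tauD I T T' : tau I (T + T') = tau I T + tau I T'.
Proof. exact: linearDl. Qed.

Lemma tauZ I c T : tau I (c *: T) = c * tau I T.
Proof. exact: linearZl_LR. Qed.

Lemma tau_inj T T' : (forall I, tau I T = tau I T') -> T = T'.
Proof. by move=> TT; rewrite [T]E_span [T']E_span; apply: eq_bigr => I _; rewrite TT. Qed.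

Lemma dimW : \dim {:W} = #|{: index}|.
Proof.
pose s := [tuple E (enum_val i) | i < #|{: index}|].
have sE c : \sum_(i < #|{: index}|) c i *: s`_i = \sum_I c (enum_rank I) *: E I.
  rewrite (reindex (@enum_rank _)) /=; last by exists enum_val => i _; rewrite ?enum_rankK ?enum_valK.
  by apply: eq_bigr => I _; rewrite -(tnth_nth 0 s) tnth_mktuple enum_rankK.
suff : basis_of {:W} s by apply: vector.size_basis.
apply/andP; split.
  apply/eqP/vspaceP => T; rewrite memvf [T]E_span; apply: memv_suml => I _.
  by rewrite memvZ // memv_span //; apply/tnthP; exists (enum_rank I); rewrite tnth_mktuple enum_rankK.
apply/freeP => c; rewrite sE => c0 i; have := tauE (fun I => c (enum_rank I)) (enum_val i).
by rewrite c0 /tau linear0l enum_valK.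
Qed.

(** This eliminates the vectors [v]: proportionality to [x] becomes orthogonality to everything
    orthogonal to [x]. *)
Definition kalman_cond T x := forall i y, q x y = 0 ->
  qF T (tens [eta (fun=> x) with i |-> y]) = 0.

(** A multiple of [x] kills the orthogonal of [x]. Conversely, as [x] is anisotropic, each [y] is a
    multiple of [x] plus a vector orthogonal to [x], so the contraction is determined by its value
    at [x]. *)
Lemma kalman_condP (X : proj V) x T : line X = <[x]>%VS -> q x x != 0 ->
  singular_tuple tens q qF T (fun=> X) <-> kalman_cond T x.
Proof.
move=> Xx qx; have x0 : x != 0 := line_nz Xx.
split=> [[x' Xx' sing] i y qxy|cond].
  have /choice[c x'E] : forall j, exists c, x = c *: x' j.
    by move=> j; apply/vlineP; rewrite -Xx' Xx memv_line.
  have [v vE vx] := sing i.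
  have qv : q v y = 0.
    have x'i0 : x' i != 0 by apply: contraNneq x0 => x'0; rewrite (x'E i) x'0 scaler0.
    move: vx; rewrite free_cons seq1_free x'i0 andbT negbK span_seq1 => /vlineP[b ->].
    have ci0 : c i != 0 by apply: contraNneq x0 => ci0; rewrite (x'E i) ci0 scale0r.
    move: qxy; rewrite (x'E i) linearZl_LR /= => /eqP; rewrite mulf_eq0 (negPf ci0) /= => /eqP x'y.
    by rewrite linearZl_LR /= x'y mulr0.
  rewrite vE in qv; rewrite -[RHS](mulr0 (\prod_(j | j != i) c j)) -qv !qF_tens mulr_sumr.
  apply: eq_bigr => I _; rewrite [RHS]mulrCA; congr (_ * _).
  rewrite (bigD1 i) //= [X in _ = _ * X](bigD1 i) //= eqxx mulrCA -big_split /=; congr (_ * _).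
  by apply: eq_bigr => j /negPf ji; rewrite ji [in LHS](x'E j) linearZr_LR.
exists (fun=> x) => // i.
(* The factor is forced by testing against [y = x]. *)
exists ((qF T (tens (fun=> x)) / q x x) *: x); last first.
  by rewrite free_cons span_seq1 memvZ // memv_line.
move=> y; rewrite linearZl_LR /=.
pose y' := y - (q x y / q x x) *: x.
have qxy' : q x y' = 0 by rewrite linearBr linearZr_LR /= divfK // subrr.
have := cond i y' qxy'; rewrite !qF_tens => cond'.
have split_y I : \prod_j q (e (I j)) ([eta fun=> x with i |-> y] j) =
    \prod_j q (e (I j)) ([eta fun=> x with i |-> y'] j)
    + q x y / q x x * \prod_j q (e (I j)) x.
  rewrite (bigD1 i) //= [X in _ = X + _](bigD1 i) //= [X in _ = _ + _ * X](bigD1 i) //= eqxx.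
  set p0 := \prod_(j | j != i) q (e (I j)) x.
  have eqp z : \prod_(j | j != i) q (e (I j)) (if j == i then z else x) = p0.
    by apply: eq_bigr => j /negPf ->.
  by rewrite !eqp linearBr linearZr_LR /=; ring.
under [RHS]eq_bigr => I _ do rewrite split_y mulrDr.
rewrite big_split /= cond' add0r mulrC [RHS](_ : _ = q x y / q x x * \sum_I tau I T * \prod_j q (e (I j)) x).
  by rewrite mulrA mulrAC -mulrA [X in _ = X]mulrC; ring.
by rewrite mulr_sumr; apply: eq_bigr => I _; rewrite mulrCA.
Qed.

Lemma kalman_condZ T c x : c != 0 -> kalman_cond T x -> kalman_cond T (c *: x).
Proof.
move=> c0 cond i y; rewrite linearZl_LR /= => /eqP; rewrite mulf_eq0 (negPf c0) /= => /eqP qxy.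
rewrite -[RHS](mulr0 (\prod_(j : 'I_k.+1 | j != i) c)) -(cond i y qxy) !qF_tens mulr_sumr.
apply: eq_bigr => I _; rewrite [RHS]mulrCA; congr (_ * _).
rewrite (bigD1 i) //= [X in _ = _ * X](bigD1 i) //= eqxx [RHS]mulrCA -big_split /=; congr (_ * _).
by apply: eq_bigr => j /negPf ji; rewrite ji linearZr_LR.
Qed.

(* [- q w w] times the reflection in the hyperplane orthogonal to [w]: unlike
   the reflection itself, it is polynomial in [w]. *)
Definition refl w v := (2 * q v w) *: w - q w w *: v.

Lemma refl_sym w u v : q (refl w u) v = q u (refl w v).
Proof.
rewrite /refl linearBl linearBr !linearZl_LR !linearZr_LR /=.
by rewrite [q w v]qC; ring.
Qed.

Lemma reflK w v : refl w (refl w v) = q w w ^+ 2 *: v.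
Proof.
have qw : q (refl w v) w = q v w * q w w.
  by rewrite /refl linearBl !linearZl_LR /=; ring.
rewrite {1}/refl qw /refl scalerBr !scalerA opprB addrCA -scalerBl expr2.
by rewrite (_ : _ - _ = 0) ?scale0r ?addr0 //; ring.
Qed.

Lemma reflZl w c v : refl (c *: w) v = c ^+ 2 *: refl w v.
Proof.
rewrite /refl !linearZl_LR !linearZr_LR /= scalerBr !scalerA.
by congr (_ *: _ - _ *: _); ring.
Qed.

Lemma q_refl w u v : q (refl w u) (refl w v) = q w w ^+ 2 * q u v.
Proof. by rewrite refl_sym reflK linearZr_LR. Qed.

(** The tensor power of [refl w]: by self-adjointness its coefficient along [E I] is found by
    reflecting the basis vectors instead of [T]. *)
Definition tens_refl w T := \sum_(I : index) qF T (tens (fun j => refl w (e (I j)))) *: E I.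

Lemma tau_tens_refl w I T : tau I (tens_refl w T) = qF T (tens (fun j => refl w (e (I j)))).
Proof. exact: (tauE (fun J => qF T (tens (fun j => refl w (e (J j)))))). Qed.

Lemma refl_expand w y : refl w y = \sum_a q (e a) y *: refl w (e a).
Proof.
rewrite {1}[y]e_span /refl linear_sumlz mulr_sumr scaler_suml scaler_sumr -sumrB.
apply: eq_bigr => a _; rewrite linearZl_LR /= [q y _]qC scalerBr !scalerA.
by congr (_ *: _ - _ *: _); ring.
Qed.

(** Expanding each [refl w (y j)] in the basis [e] turns the product over slots into a sum over
    multi-indices. *)
Lemma qF_tens_refl w T (y : 'I_k.+1 -> V) :
  qF (tens_refl w T) (tens y) = qF T (tens (fun j => refl w (y j))).
Proof.
rewrite !qF_tens.
under eq_bigr do rewrite tau_tens_refl qF_tens mulr_suml.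
rewrite exchange_big /=; apply: eq_bigr => J _.
under eq_bigr do rewrite -mulrA -big_split /=.
rewrite -mulr_sumr; congr (_ * _).
rewrite -(bigA_distr_bigA (fun j a => q (e (J j)) (refl w (e a)) * q (e a) (y j))).
apply: eq_bigr => j _; rewrite (refl_expand w (y j)) linear_sumr.
by apply: eq_bigr => a _; rewrite linearZr_LR /= mulrC.
Qed.

Lemma tens_reflK w T : tens_refl w (tens_refl w T) = (q w w ^+ 2) ^+ k.+1 *: T.
Proof.
apply: tau_inj => I; rewrite tauZ tau_tens_refl qF_tens_refl.
rewrite qF_tens [in RHS](E_span T) /tau linear_sumlz mulr_sumr.
apply: eq_bigr => J _; rewrite linearZl_LR /= hqF mulrCA; congr (_ * _).
under eq_bigr do rewrite reflK linearZr_LR /=.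
by rewrite big_split /= prodr_const card_ord.
Qed.

Lemma tens_reflZ w c T : tens_refl w (c *: T) = c *: tens_refl w T.
Proof. by apply: tau_inj => I; rewrite tauZ !tau_tens_refl linearZl_LR. Qed.

(** [refl w] multiplies [q] by a constant, so it preserves orthogonality of the test vectors. *)
Lemma kalman_cond_refl w T x : kalman_cond T (refl w x) -> kalman_cond (tens_refl w T) x.
Proof.
move=> cond i y qxy; rewrite qF_tens_refl -[RHS](cond i (refl w y)); last first.
  by rewrite q_refl qxy mulr0.
by congr (qF T (tens _)); apply/funext => j /=; case: eqP.
Qed.

(** Since [e ord0] and [x] both have square 1, the reflection attached to their sum or difference
    exchanges their lines. *)
Lemma refl_transitive x : q x x = 1 -> exists u c,
  [/\ q u (e ord0) = 0, c != 0, q (e ord0 + u) (e ord0 + u) != 0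
    & refl (e ord0 + u) (e ord0) = c *: x].
Proof.
move=> qx; set e0 := e ord0; have qe0 : q e0 e0 = 1 by rewrite e_orth eqxx.
(* The sign [s] makes [w] below anisotropic, with a nonzero component along [e0] by which it can be
   divided. *)
have [s ss s0] : exists2 s : K, s * s = 1 & q e0 x + s != 0.
  have [x1|x1] := eqVneq (q e0 x) 1.
    by exists 1; rewrite ?mulr1 // x1 -[1 + 1]/(2%:R) pnatr_eq0.
  by exists (- 1); [rewrite mulrNN mulr1|rewrite subr_eq0].
pose w := x + s *: e0; pose a := q e0 x + s.
have qw : q w w = 2 * s * a.
  have -> : 2 * s * a = s * s + 2 * s * q e0 x + s * s by rewrite /a; ring.
  rewrite /w linearDl !linearDr !linearZl_LR !linearZr_LR /= qx qe0 [q x e0]qC mulr1 ss.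
  by ring.
have s_neq0 : s != 0 by apply: contra_eq_neq ss => ->; rewrite mul0r eq_sym oner_neq0.
have two0 : (2 : K) != 0 by rewrite pnatr_eq0.
have qe0w : q e0 w = a by rewrite /w linearDr linearZr_LR /= qe0 mulr1.
have wE : e0 + (a^-1 *: w - e0) = a^-1 *: w by rewrite addrC subrK.
exists (a^-1 *: w - e0), (a^-1 ^+ 2 * (2 * a)); split.
- by rewrite linearBl linearZl_LR /= [q w e0]qC qe0w qe0 mulVf ?subrr.
- by rewrite !mulf_neq0 ?expf_neq0 ?invr_neq0.
- by rewrite wE linearZl_LR linearZr_LR /= qw !mulf_neq0 ?invr_neq0.
- rewrite wE reflZl -[RHS]scalerA; congr (_ *: _).
  rewrite /refl -/e0 qe0w qw /w scalerDr scalerA [2 * s * a](_ : _ = 2 * a * s) ?addrK //.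
  by ring.
Qed.

(** * Multi-indices and the Kalman condition at the base vector *)

Definition nonzeros I := #|[pred j | I j != ord0]|.
Definition single I := nonzeros I == 1%N.
(* The good coordinates parametrize the variety: those with the single nonzero
   index in slot 0 give the direction of the center of reflection, the others
   the tensor at the base point [e ord0]. *)
Definition bad I := single I && (I ord0 == ord0).

(** An index with a nonzero entry outside slot [i] is killed by pairing with [e ord0], one with
    entry [ord0] in slot [i] by pairing with [y]. Only single indices remain. *)
Lemma kalman_cond_e0 S : kalman_cond S (e ord0) <-> forall I, single I -> tau I S = 0.
Proof.
split=> [cond I /eqP/mem_card1[i Ii]|S0 i y qy].
  have Iz j : j != i -> I j = ord0.
    by move=> ji; have := Ii j; rewrite !inE (negPf ji) => /negbFE/eqP.
  have Ni : I i != ord0 by have := Ii i; rewrite !inE eqxx.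
  have qI : q (e ord0) (e (I i)) = 0 by rewrite e_orth eq_sym (negPf Ni).
  rewrite -[RHS](cond i _ qI) /tau; congr (qF S (tens _)); apply/funext => j /=.
  by case: eqP => [->//|/eqP ji]; rewrite Iz.
rewrite qF_tens big1 // => I _.
have [[j ji Ij]|Iz] := pselect (exists2 j, j != i & I j != ord0).
  by rewrite (bigD1 j) //= (negPf ji) e_orth (negPf Ij) mul0r mulr0.
have {}Iz j : j != i -> I j = ord0.
  by move=> ji; apply: contrapT => /eqP Ij; apply: Iz; exists j.
have [Ii|Ii] := eqVneq (I i) ord0.
  by rewrite (bigD1 i) //= eqxx Ii qy mul0r mulr0.
rewrite S0 ?mul0r // /single /nonzeros -(card1 i); apply/eqP/eq_card => j.
rewrite !inE; have [->//|ji] := eqVneq j i.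
by rewrite Iz // eqxx.
Qed.

Definition slot0 (a : 'I_n.+1) : index := [ffun j => if j == ord0 then a else ord0].

Lemma single_slot0 a : a != ord0 -> single (slot0 a).
Proof.
move=> a0; rewrite /single /nonzeros -(card1 (ord0 : 'I_k.+1)); apply/eqP/eq_card => j.
by rewrite !inE ffunE; case: (eqVneq j ord0) => _; rewrite ?eqxx.
Qed.

Lemma good_singleP I : single I -> ~~ bad I -> I ord0 != ord0 /\ I = slot0 (I ord0).
Proof.
rewrite /bad => sI; rewrite sI => I0; split=> //.
move: sI => /eqP/mem_card1[i Ii].
have i0 : ord0 = i by have := Ii ord0; rewrite !inE I0 => /esym/eqP.
apply/ffunP => j; rewrite ffunE; case: (eqVneq j ord0) => [->//|j0].
by have := Ii j; rewrite !inE -i0 (negPf j0) => /negbFE/eqP.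
Qed.

(** A bad index amounts to a slot other than the first and a nonzero value in it. With [k.+1]
    factors of dimension [n.+1] this count is the codimension. *)
Lemma card_bad : #|[pred I | bad I]| = (k * n)%N.
Proof.
pose f (x : 'I_k * 'I_n) : index :=
  [ffun j => if j == lift ord0 x.1 then lift ord0 x.2 else ord0].
have f_inj : injective f.
  move=> [i a] [j b] /ffunP/(_ (lift ord0 i)); rewrite !ffunE /= eqxx.
  rewrite (inj_eq (@lift_inj _ ord0)); case: eqVneq => [-> /lift_inj -> //|_ /eqP].
  by rewrite eq_sym (negPf (neq_lift _ _)).
rewrite -[k in RHS]card_ord -[n in RHS]card_ord -card_prod -(card_codom f_inj).
apply: eq_card => I; rewrite !inE /bad; apply/idP/codomP => [/andP[]|[[i a] ->]].
  move=> /eqP/mem_card1[i Ii] /eqP I0.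
  have Ni : I i != ord0 by have := Ii i; rewrite !inE eqxx.
  have i0 : ord0 != i by apply: contraNneq Ni => <-; rewrite I0.
  rewrite eq_sym in Ni.
  have [i' iE _] := unlift_some i0; have [a Ia _] := unlift_some Ni.
  exists (i', a); apply/ffunP => j; rewrite ffunE /= -iE -Ia; case: (eqVneq j i) => [->//|ji].
  by have := Ii j; rewrite !inE (negPf ji) => /negbFE/eqP.
rewrite ffunE /= eqxx andbT /single /nonzeros.
rewrite -(card1 (lift ord0 i)); apply/eqP/eq_card => j; rewrite !inE ffunE /=.
by case: (eqVneq j (lift ord0 i)) => _; rewrite ?eqxx // eq_sym neq_lift.
Qed.
Lemma tau_E I J : tau I (E J) = (J == I)%:R.
Proof.
rewrite -[RHS](tauE (fun J' => (J == J')%:R)); congr tau.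
rewrite (bigD1 J) //= eqxx scale1r big1 ?addr0 // => J' /negPf J'J.
by rewrite eq_sym J'J scale0r.
Qed.

(** * The parametrization *)

Local Notation d := #|[pred I | ~~ bad I]|.
Definition rho (r : 'I_d) : index := enum_val r.

Lemma rho_good r : ~~ bad (rho r).
Proof. by have := enum_valP r; rewrite inE. Qed.

Lemma sum_rho (M : nmodType) (F : index -> M) :
  \sum_(r < d) F (rho r) = \sum_(I | ~~ bad I) F I.
Proof. by rewrite -[LHS](big_enum_val (A := [pred I | ~~ bad I])). Qed.

Implicit Types z : 'rV[K]_d.

Definition direction z : V :=
  \sum_r (if single (rho r) then z 0 r else 0) *: e (rho r ord0).
Definition center z : V := e ord0 + direction z.
Definition coefs z : W :=
  \sum_r (if single (rho r) then 0 else z 0 r) *: E (rho r).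
Definition param z : W := tens_refl (center z) (coefs z).
Definition qcenter z : K := q (center z) (center z).

Lemma q_direction z r : single (rho r) -> q (direction z) (e (rho r ord0)) = z 0 r.
Proof.
move=> sr; have [r0 rE] := good_singleP sr (rho_good r).
rewrite /direction linear_sumlz (bigD1 r) //= linearZl_LR /= sr e_orth eqxx mulr1.
rewrite big1 ?addr0 // => r' r'r; rewrite linearZl_LR /= e_orth.
case: ifP => [sr'|_]; last by rewrite mul0r.
case: eqP => [r'r0|_]; last by rewrite mulr0.
have [_ r'E] := good_singleP sr' (rho_good r').
by case/eqP: r'r; apply: enum_val_inj; rewrite -/(rho r) -/(rho r') rE r'E r'r0.
Qed.

Lemma q_direction0 z : q (direction z) (e ord0) = 0.
Proof.
rewrite /direction linear_sumlz big1 // => r _; rewrite linearZl_LR /= e_orth.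
case: ifP => [sr|_]; last by rewrite mul0r.
by have [/negPf -> _] := good_singleP sr (rho_good r); rewrite mulr0.
Qed.

Lemma tau_coefs z r : tau (rho r) (coefs z) = if single (rho r) then 0 else z 0 r.
Proof.
rewrite /tau /coefs linear_sumlz (bigD1 r) //= linearZl_LR /= -/(tau _ _) tau_E eqxx mulr1.
rewrite big1 ?addr0 // => r' /negPf r'r; rewrite linearZl_LR /= -/(tau _ _) tau_E.
by rewrite (inj_eq enum_val_inj) r'r mulr0.
Qed.

Lemma tau_coefs_single z I : single I -> tau I (coefs z) = 0.
Proof.
move=> sI; rewrite /tau /coefs linear_sumlz big1 // => r _; rewrite linearZl_LR /= -/(tau _ _) tau_E.
by case: eqP => [->|]; rewrite ?sI ?mul0r ?mulr0.
Qed.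

(** The Kalman condition at [e ord0] kills the single coordinates of [S], so the good single entries
    of [z] are free to store [u], and the others store [S]. *)
Lemma param_surj u S : q u (e ord0) = 0 -> kalman_cond S (e ord0) ->
  exists z, direction z = u /\ coefs z = S.
Proof.
move=> qu /kalman_cond_e0 S0.
exists (\row_r (if single (rho r) then q u (e (rho r ord0)) else tau (rho r) S)); split.
  transitivity (\sum_r (if single (rho r) then q u (e (rho r ord0)) else 0) *: e (rho r ord0)).
    by apply: eq_bigr => r _; rewrite mxE; case: (single _).
  rewrite (sum_rho (fun I => (if single I then q u (e (I ord0)) else 0) *: e (I ord0))).
  rewrite [RHS]e_span [RHS](bigD1 ord0) //= qu scale0r add0r.
  rewrite (bigID single) /= addrC big1 ?add0r; last by move=> I /andP[_ /negPf ->]; rewrite scale0r.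
  rewrite (reindex_onto slot0 (fun I : index => I ord0)) /=; last first.
    by move=> I /andP[gI sI]; have [_ <-] := good_singleP sI gI.
  apply: eq_big => [a|a /andP[/andP[_ sa] _]]; last by rewrite sa ffunE.
  rewrite /bad ffunE /= eqxx andbT; have [->|a0] := eqVneq a ord0.
    by rewrite ?eqxx /= ?andbT; case: (single _).
  by rewrite andbF single_slot0.
transitivity (\sum_r (if single (rho r) then 0 else tau (rho r) S) *: E (rho r)).
  by apply: eq_bigr => r _; rewrite mxE; case: (single _).
rewrite (sum_rho (fun I => (if single I then 0 else tau I S) *: E I)).
rewrite [RHS]E_span [RHS](bigID (fun I => ~~ bad I)) /= [X in _ = _ + X]big1 ?addr0.
  by apply: eq_bigr => I _; case: ifP => // sI; rewrite S0.
by move=> I; rewrite negbK => /andP[sI _]; rewrite S0 // scale0r.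
Qed.

(** A reflection carries a singular vector to [e ord0], and reflecting twice returns [T] up to a
    nonzero scalar. In the other direction, the reflected [e ord0] is an anisotropic singular vector
    of [param z]. *)
Lemma kalman_param : kalman_nor tens q qF = image_closure param qcenter.
Proof.
rewrite /kalman_nor /image_closure; congr closure; apply/seteqP; split=> P /=.
  move=> [T PT [X nX singT]]; have [x Xx] := line_gen X.
  have qx : q x x != 0.
    apply/eqP => qx; apply: nX => y; rewrite Xx => /vlineP[c ->].
    by rewrite linearZl_LR linearZr_LR /= qx !mulr0.
  have cond := (kalman_condP T Xx qx).1 singT.
  (* Dividing by a square root gives [x] square 1, the square of [e ord0]. *)
  have c0 : (sqrtC (q x x))^-1 != 0 by rewrite invr_neq0 // sqrtC_eq0.
  have q1 : q ((sqrtC (q x x))^-1 *: x) ((sqrtC (q x x))^-1 *: x) = 1.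
    rewrite linearZl_LR linearZr_LR /= mulrA -expr2 exprVn sqrtCK.
    by rewrite mulVf.
  have [u [b [ue0 b0 qw wE]]] := refl_transitive q1.
  have condS : kalman_cond (tens_refl (e ord0 + u) T) (e ord0).
    by apply: kalman_cond_refl; rewrite wE; do 2!apply: kalman_condZ => //.
  have [z [zu zS]] := param_surj ue0 condS.
  exists z; first by rewrite /qcenter /center zu.
  rewrite PT /param zS /center zu tens_reflK; apply/eqP.
  set c := _ ^+ _; have cN0 : c != 0 by rewrite !expf_neq0.
  have TE : T = c^-1 *: (c *: T) by rewrite scalerK.
  rewrite eqEdim -memvE !dim_vline scaler_eq0 (negPf cN0) leqnn andbT.
  by rewrite {1}TE memvZ // memv_line.
move=> [z qz Pz]; exists (param z) => //.
have q0 : q (refl (center z) (e ord0)) (refl (center z) (e ord0)) != 0.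
  by rewrite q_refl e_orth eqxx mulr1 expf_neq0.
have x0 : refl (center z) (e ord0) != 0.
  by apply: contraNneq q0 => ->; rewrite linear0l.
exists (pline x0).
  by move=> /(_ _ (memv_line _))/eqP; rewrite (negPf q0).
apply/(kalman_condP _ (line_pline x0) q0)/kalman_cond_refl; rewrite reflK.
apply: kalman_condZ; first by rewrite expf_neq0.
by apply/kalman_cond_e0 => I; exact: tau_coefs_single.
Qed.

(** * Polynomiality of the parametrization *)

Lemma q_center z a : q (e a) (center z) =
  (a == ord0)%:R + \sum_r (if single (rho r) then z 0 r else 0) * q (e a) (e (rho r ord0)).
Proof.
rewrite /center linearDr e_orth linear_sumr; congr (_ + _).
by apply: eq_bigr => r _; rewrite linearZr_LR.
Qed.

Lemma polymap_entry r : polymap (fun z => z 0 r).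
Proof. by apply: polymap_linear => c z z'; rewrite !mxE. Qed.

Lemma polymap_if_entry (b : bool) r :
  polymap (fun z => if b then z 0 r else 0).
Proof. by case: b; [exact: polymap_entry|exact: polymapC]. Qed.

Lemma polymap_q_center a : polymap (fun z => q (e a) (center z)).
Proof.
apply: (polymap_ext (fun z => esym (q_center z a))).
apply: polymapD; first exact: polymapC.
apply: polymap_sum => r; apply: polymapM; [exact: polymap_if_entry|exact: polymapC].
Qed.

Lemma polymap_qcenter : polymap qcenter.
Proof.
apply: (@polymap_ext _ _ (fun z => \sum_a q (e a) (center z) * q (e a) (center z))).
  move=> z; rewrite /qcenter [in RHS](e_span (center z)) linear_sumlz.
  by apply: eq_bigr => a _; rewrite linearZl_LR /= [q _ (e a)]qC -e_span.
apply: polymap_sum => a; apply: polymapM; exact: polymap_q_center.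
Qed.

Lemma q_refl_basis w a b : q (e a) (refl w (e b)) =
  2 * q (e b) w * q (e a) w - q w w * (a == b)%:R.
Proof. by rewrite /refl linearBr !linearZr_LR /= e_orth. Qed.

Lemma tau_param z I : tau I (param z) =
  \sum_J tau J (coefs z) * \prod_j q (e (J j)) (refl (center z) (e (I j))).
Proof. by rewrite tau_tens_refl qF_tens. Qed.

Lemma polymap_tau_param I : polymap (fun z => tau I (param z)).
Proof.
apply: (polymap_ext (fun z => esym (tau_param z I))); apply: polymap_sum => J.
apply: polymapM.
  apply: (@polymap_ext _ _ (fun z => \sum_r (if ~~ single (rho r) then z 0 r else 0) * tau J (E (rho r)))).
    move=> z; rewrite /tau /coefs linear_sumlz; apply: eq_bigr => r _.
    by rewrite linearZl_LR /= if_neg.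
  by apply: polymap_sum => r; apply: polymapM; [exact: polymap_if_entry|exact: polymapC].
apply: polymap_prod => j.
apply: (polymap_ext (fun z => esym (q_refl_basis _ _ _))).
rewrite /=; apply: (@polymap_ext _ _ (fun z =>
  (2 * q (e (I j)) (center z)) * q (e (J j)) (center z)
  + qcenter z * (- (J j == I j)%:R))); first by move=> z; rewrite mulrN.
apply: polymapD; apply: polymapM.
- by apply: polymapM; [exact: polymapC|exact: polymap_q_center].
- exact: polymap_q_center.
- exact: polymap_qcenter.
- exact: polymapC.
Qed.

Lemma polymap_coord_param i : polymap (fun z => coord (vbasis {:W}) i (param z)).
Proof.
apply: (@polymap_ext _ _ (fun z => \sum_I tau I (param z) * coord (vbasis {:W}) i (E I))).
  by move=> z; rewrite [in RHS](E_span (param z)) linear_sum; apply: eq_bigr => I _; rewrite linearZ.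
by apply: polymap_sum => I; apply: polymapM; [exact: polymap_tau_param|exact: polymapC].
Qed.

(** The center has [e ord0]-component 1, so only the tensor part is scaled and the direction is
    kept. *)
Lemma param_scale z c : qcenter z != 0 -> c != 0 ->
  exists2 z', qcenter z' != 0 & param z' = c *: param z.
Proof.
move=> qz _; have condS : kalman_cond (c *: coefs z) (e ord0).
  by apply/kalman_cond_e0 => I sI; rewrite tauZ tau_coefs_single // mulr0.
have [z' [zu zS]] := param_surj (q_direction0 z) condS.
exists z'; first by rewrite /qcenter /center zu.
by rewrite /param /center zu zS tens_reflZ.
Qed.

Lemma base_point : exists z,
  [/\ direction z = 0, coefs z = E [ffun=> ord0], qcenter z != 0 & param z != 0].
Proof.
have [||z [zu zS]] := @param_surj 0 (E [ffun=> ord0]).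
- by rewrite linear0l.
- apply/kalman_cond_e0 => I sI; rewrite tau_E; case: eqP => // Ieq.
  move: sI; rewrite -Ieq /single /nonzeros eq_card0 // => j.
  by rewrite !inE ffunE eqxx.
exists z; split=> //; rewrite ?/qcenter ?/param /center zu addr0 ?e_orth ?eqxx ?oner_neq0 //.
suff : tau [ffun=> ord0] (tens_refl (e ord0) (coefs z)) != 0.
  by apply: contra_neq => ->; exact: linear0l.
rewrite tau_tens_refl zS hqF big1 ?oner_neq0 // => j _.
by rewrite !ffunE q_refl_basis !e_orth eqxx mulr1n; ring.
Qed.

Lemma direction_line z0 z t : direction (z0 + t *: z) = direction z0 + t *: direction z.
Proof.
rewrite /direction scaler_sumr -big_split /=; apply: eq_bigr => r _.
by rewrite scalerA -scalerDl !mxE; case: ifP => //; rewrite mulr0 addr0.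
Qed.

Lemma coefs_line z0 z t : coefs (z0 + t *: z) = coefs z0 + t *: coefs z.
Proof.
rewrite /coefs scaler_sumr -big_split /=; apply: eq_bigr => r _.
by rewrite scalerA -scalerDl !mxE; case: ifP => //; rewrite mulr0 addr0.
Qed.

(** * First-order expansion at the base point *)

Section Line.
Variables (u : V) (u0 : q u (e ord0) = 0).

Definition qline : {poly K} := 1 + q u u *: 'X^2.

Lemma qlineE t : q (e ord0 + t *: u) (e ord0 + t *: u) = qline.[t].
Proof.
rewrite linearDl !linearDr !linearZl_LR !linearZr_LR /= e_orth eqxx u0 [q _ u]qC u0.
by rewrite /qline !hornerE /= mulr1n; ring.
Qed.

Definition reflline a b : {poly K} :=
  2 *: (((b == ord0)%:R)%:P + q u (e b) *: 'X) * (((a == ord0)%:R)%:P + q u (e a) *: 'X)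
  - (a == b)%:R *: qline.

Lemma refllineE t a b : q (e a) (refl (e ord0 + t *: u) (e b)) = (reflline a b).[t].
Proof.
rewrite q_refl_basis qlineE /reflline !linearDr !linearZr_LR /= !e_orth ![q _ u]qC.
by rewrite !hornerE; ring.
Qed.

Lemma reflline_diag a b : (reflline a b).[0] =
  (a == b)%:R * (if b == ord0 then 1 else -1).
Proof.
rewrite hornerD hornerN hornerM !hornerZ !hornerD !hornerC !hornerZ !hornerX hornerXn.
rewrite expr2 !mulr0 !addr0 mulr1.
have [->|ab] := eqVneq a b; first by case: (b == ord0); rewrite /=; ring.
have [b0|_] := eqVneq b ord0; last by rewrite /= !mulr0 !mul0r subrr.
by rewrite -b0 (negPf ab) /= !mulr0 mul0r subrr.
Qed.

Lemma reflline0 b t : (reflline ord0 b).[t] =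
  (if b == ord0 then 2 - qline.[t] else 2 * q u (e b) * t).
Proof.
rewrite hornerD hornerN hornerM !hornerZ !hornerD !hornerC !hornerZ !hornerX u0.
rewrite eqxx [ord0 == b]eq_sym; case: eqVneq => [->|_]; rewrite ?u0 /=; ring.
Qed.

(* To first order in [t], the point [e0] moves along the curve in direction [2 u]. *)
Lemma prod_reflline I : ~~ bad I -> exists A : {poly K},
  (forall t, \prod_j (reflline ord0 (I j)).[t] = (I == [ffun=> ord0])%:R + t * A.[t]) /\
  A.[0] = if single I then 2 * q u (e (I ord0)) else 0.
Proof.
move=> gI.
(* Each slot with a nonzero entry contributes a factor [t], which is left out of [g j]. *)
pose g j : {poly K} := if I j == ord0 then 2 - qline else (2 * q u (e (I j)))%:P.
have prodE t : \prod_j (reflline ord0 (I j)).[t] = (\prod_j g j).[t] * t ^+ nonzeros I.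
  rewrite horner_prod /nonzeros -sum1_card -prodrXr [X in _ * X]big_mkcond /= -big_split /=.
  apply: eq_bigr => j _; rewrite reflline0 /g inE; case: eqP => _ /=; rewrite !hornerE //.
have [nz0|nz_gt0] := posnP (nonzeros I).
  have Iz j : I j = ord0.
    by have /card0_eq/(_ j) := nz0; rewrite inE => /negbFE/eqP.
  have I0 : I = [ffun=> ord0] by apply/ffunP => j; rewrite ffunE.
  (* [2 - qline] is [1 - q u u *: 'X^2]; the geometric sum extracts ['X^2] from its power minus 1,
     and one ['X] stays in the witness. *)
  exists (- (q u u *: 'X) * \sum_(i < k.+1) (2 - qline) ^+ i); split; last first.
    by rewrite hornerM hornerN hornerZ hornerX mulr0 oppr0 mul0r /single nz0.
  move=> t; rewrite prodE nz0 expr0 mulr1 I0 eqxx.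
  have -> : \prod_j g j = (2 - qline) ^+ k.+1.
    by rewrite -[in RHS](card_ord k.+1) -prodr_const; apply: eq_bigr => j _; rewrite /g Iz eqxx.
  have := congr1 (horner^~ t) (subrX1 (2 - qline) k.+1).
  rewrite hornerD hornerN [in X in _ - X]hornerC => /(canRL (subrK _)) ->.
  rewrite addrC !hornerM; congr (_ + _); rewrite mulrA; congr (_ * _).
  by rewrite /qline !hornerE /=; ring.
(* One [t] is taken out; the remaining power vanishes at 0 unless the index is single. *)
exists (\prod_j g j * 'X^((nonzeros I).-1)); split.
  move=> t; rewrite prodE hornerM hornerXn -{1}(prednK nz_gt0) exprS mulrCA.
  rewrite (_ : (I == _) = false) ?add0r //; apply/negP => /eqP I0.
  by move: nz_gt0; rewrite /nonzeros eq_card0 // => j; rewrite inE I0 ffunE eqxx.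
rewrite hornerM hornerXn; case: ifP => sI; last first.
  rewrite expr0n -[_.-1 == 0%N]eqSS prednK //.
  by move: sI; rewrite /single => ->; rewrite mulr0.
have [I0 IE] := good_singleP sI gI; rewrite (eqP sI) expr0 mulr1 horner_prod (bigD1 ord0) //=.
rewrite {1}/g (negPf I0) hornerC big1 ?mulr1 // => j j0.
by rewrite /g IE ffunE (negPf j0) eqxx /= /qline !hornerE /=; ring.
Qed.

End Line.

Lemma card_good : (d + k * n)%N = \dim {:W}.
Proof.
rewrite dimW -card_bad addnC -(cardC [pred I | bad I]); congr (_ + _)%N.
Qed.

(** The functions are the good coordinates, shifted to vanish at the base tensor. Along a line of
    parameters each is [t] times a polynomial whose value at 0 can be prescribed, so the lowest part
    of a relation vanishes everywhere. *)
Lemma algindep_param : exists f : 'I_d -> {mpoly K[\dim {:W}]},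
  algindep (image_closure param qcenter) f.
Proof.
pose o : index := [ffun=> ord0].
pose f r : {mpoly K[\dim {:W}]} :=
  \sum_(i < \dim {:W}) tau (rho r) (vbasis {:W})`_i *: 'X_i - ((rho r == o)%:R)%:MP.
have fE r T : polyfun (f r) T = tau (rho r) T - (rho r == o)%:R.
  rewrite /polyfun mevalB mevalC; congr (_ - _).
  rewrite raddf_sum /= {2}(coord_vbasis (memvf T)) /tau linear_sumlz.
  by apply: eq_bigr => i _; rewrite mevalZ mevalXU linearZl_LR /= mulrC.
have [z0 [z0u z0S qz0 pz0]] := base_point.
exists f => P P0; apply: contrapT => /lowest_part[Q QN0 Qlow]; apply: QN0.
(* The diagonal entries of the differential at the base point: 2 because the base vector moves along
   [2 u], otherwise the sign by which the reflection attached to [e ord0] acts on [E (rho r)]. *)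
pose sg r : K := if single (rho r) then 2 else \prod_j (if rho r j == ord0 then 1 else -1).
have sg0 r : sg r != 0.
  rewrite /sg; case: ifP => _; first by rewrite pnatr_eq0.
  by apply/prodf_neq0 => j _; case: ifP; rewrite ?oppr_eq0 oner_neq0.
apply: mpoly_eq0_meval => x; pose z := \row_r (x r / sg r).
pose u := direction z; have u0 : q u (e ord0) = 0 := q_direction0 z.
have /choice[A /all_and2[AE A0]] : forall r, exists A : {poly K},
  (forall t, \prod_j (reflline u ord0 (rho r j)).[t] = (rho r == o)%:R + t * A.[t]) /\
  A.[0] = if single (rho r) then 2 * q u (e (rho r ord0)) else 0.
  by move=> r; exact: (prod_reflline u0 (rho_good r)).
pose G r : {poly K} := A r + \sum_J tau J (coefs z) *: \prod_j reflline u (J j) (rho r j).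
have GE r t : tau (rho r) (param (z0 + t *: z)) = (rho r == o)%:R + t * (G r).[t].
  rewrite tau_param coefs_line z0S /center direction_line z0u add0r -/u.
  under eq_bigr do rewrite tauD tauZ mulrDl.
  rewrite big_split /= (bigD1 o) //= tau_E eqxx mul1r [X in _ + X + _]big1 ?addr0; last first.
    by move=> J /negPf Jo; rewrite tau_E eq_sym Jo mul0r.
  rewrite /G hornerD mulrDr addrA; congr (_ + _).
    by rewrite -AE; apply: eq_bigr => j _; rewrite refllineE // ffunE.
  rewrite horner_sum mulr_sumr; apply: eq_bigr => J _; rewrite hornerZ horner_prod -mulrA.
  by congr (_ * (_ * _)); apply: eq_bigr => j _; rewrite refllineE.
(* At [t = 0] the reflection is diagonal, so only [J = rho r] contributes to the sum; the division
   by [sg r] in [z] then yields [x r]. *)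
have G0 r : (G r).[0] = x r.
  rewrite /G hornerD horner_sum A0 (bigD1 (rho r)) //= [X in _ + (_ + X)]big1 ?addr0; last first.
    move=> J Jr; rewrite hornerZ horner_prod.
    have [j Jj] : exists j, J j != rho r j.
      apply/existsP; apply: contraNT Jr; rewrite negb_exists => /forallP Jr.
      by apply/eqP/ffunP => j; apply/eqP; have := Jr j; rewrite negbK.
    by rewrite (bigD1 j) //= reflline_diag (negPf Jj) !mul0r mulr0.
  rewrite hornerZ tau_coefs horner_prod; under eq_bigr do rewrite reflline_diag eqxx mul1r.
  case: ifP => sr.
    by rewrite mul0r addr0 q_direction // mxE /sg sr mulrC divfK // pnatr_eq0.
  rewrite add0r mxE; have := sg0 r; rewrite /sg sr => sgr; by rewrite divfK.
transitivity (Q.@[fun r => (G r).[0]]); first by apply: meval_eq => r; rewrite G0.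
apply: (Qlow (qline u)).
  apply: contra_neq (oner_neq0 K) => ql0; have := congr1 (horner^~ 0) ql0.
  by rewrite /qline !hornerE /= !mulr0 addr0.
move=> t; apply/eqP; rewrite mulf_eq0; apply/orP.
have [qt|qt] := eqVneq (qline u).[t] 0; [by left|right]; apply/eqP.
have qzt : qcenter (z0 + t *: z) != 0.
  by rewrite /qcenter /center direction_line z0u add0r qlineE.
transitivity (P.@[fun r => polyfun (f r) (param (z0 + t *: z))]).
  by apply: meval_eq => r; rewrite fE GE addrC addKr.
(* The zero tensor gives no projective point, but it lies on the line of [param z0]. *)
have [pz|pz] := eqVneq (param (z0 + t *: z)) 0; last first.
  apply: (P0 (pline pz)); last by rewrite line_pline memv_line.
  by apply: subset_closure; exists (z0 + t *: z).
rewrite pz; apply: (P0 (pline pz0)); last by rewrite mem0v.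
by apply: subset_closure; exists z0.
Qed.
Lemma kalman_irreducible_codim : irreducible (kalman_nor tens q qF) /\
  has_codim (kalman_nor tens q qF) (k * n).
Proof.
have [z0 [_ _ qz0 pz0]] := base_point.
have nz : exists2 z, qcenter z != 0 & param z != 0 by exists z0.
rewrite kalman_param; split.
  by apply: irreducible_image_closure => //; [exact: polymap_coord_param|exact: polymap_qcenter].
split.
  apply: image_closure_chain => //.
  - exact: polymap_coord_param.
  - exact: polymap_qcenter.
  - by move=> z c; exact: param_scale.
  - by rewrite dimvf /dim /= mul1n card_good.
have [f findep] := algindep_param.
by move=> m C chC; have := chain_length chC findep; rewrite -card_good leq_add2l.
Qed.

End Tensors.

(** * Orthonormal bases and tensor coordinates *)

Section OrthonormalBasis.
Variables (R : realType) (V : vectType R[i]) (q : {biscalar V}).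

Lemma Num_real_complex (x : R[i]) : x \is Num.real -> exists r : R, x = r%:C.
Proof.
case: x => a b; rewrite realE !lecE /= => /orP[]/andP[/eqP b0 _]; exists a;
  [by rewrite b0|by rewrite -b0].
Qed.

(** Gram-Schmidt inside the real form: the coefficients subtracted are real, and positivity gives a
    real square root for the normalization, so the result stays in [S]. *)
Lemma orthonormal_step (S : set V) m (e : 'I_m -> V) :
  (forall x y, q x y = q y x) -> real_form S ->
  (forall x y, S x -> S y -> q x y \is Num.real) ->
  (forall x, S x -> x != 0 -> 0 < q x x) ->
  (forall i, S (e i)) -> (forall i j, q (e i) (e j) = (i == j)%:R) ->
  (m < \dim {:V})%N ->
  exists x, [/\ S x, q x x = 1 & forall i, q x (e i) = 0].
Proof.
move=> qC [S0 Slin Sspan _] Sreal Spos Se e_orth mV.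
pose U := <<[tuple e i | i < m]>>%VS.
(* [S] spans [V] over the complex numbers, so it does not fit in the proper subspace [U]. *)
have [s Ss sU] : exists2 s, S s & s \notin U.
  apply: contrapT => noS.
  have SU x : S x -> x \in U by move=> Sx; apply: contrapT => /negP xU; apply: noS; exists x.
  have VU : (fullv <= U)%VS.
    apply/subvP => v _; have [x [y [Sx Sy ->]]] := Sspan v.
    by rewrite memvD ?memvZ ?SU.
  by have := leq_trans (dimvS VU) (dim_span _); rewrite size_tuple leqNgt mV.
pose y := s - \sum_i q s (e i) *: e i.
have Sy : S y.
  rewrite /y; elim/big_rec: _ => [|i v _ Sv]; first by rewrite subr0.
  have [r ->] := Num_real_complex (Sreal _ _ Ss (Se i)).
  by rewrite opprD addrCA -scaleNr -raddfN; exact: Slin.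
have y0 : y != 0.
  rewrite subr_eq0; apply: contraNneq sU => ->; apply: memv_suml => i _.
  by rewrite memvZ // memv_span //; apply/tnthP; exists i; rewrite tnth_mktuple.
have ye i : q y (e i) = 0.
  rewrite /y linearBl linear_sumlz (bigD1 i) //= linearZl_LR /= e_orth eqxx mulr1.
  rewrite big1 ?addr0 ?subrr // => j /negPf ji.
  by rewrite linearZl_LR /= e_orth ji mulr0.
have qy := Spos y Sy y0; have [r rE] := Num_real_complex (gtr0_real qy).
have r0 : 0 < r by rewrite -ltcR -rE.
exists (((Num.sqrt r)^-1)%:C *: y); split.
- by rewrite -[_ *: y]addr0; exact: Slin.
- rewrite linearZl_LR linearZr_LR /= rE -!rmorphM /= mulrA -expr2 exprVn sqr_sqrtr ?ltW //.
  by rewrite mulVf ?gt_eqF.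
- by move=> i; rewrite linearZl_LR /= ye mulr0.
Qed.

Lemma orthonormal_basis n : \dim {:V} = n -> complexified_positive_definite q ->
  exists e : 'I_n -> V, (forall a b, q (e a) (e b) = (a == b)%:R) /\
    (forall v, v = \sum_a q v (e a) *: e a).
Proof.
move=> dimV [qC [S Sreal [qreal qpos]]].
have [e [Se e_orth]] : exists e : 'I_n -> V, (forall a, S (e a)) /\
    forall a b, q (e a) (e b) = (a == b)%:R.
  suff main m : (m <= n)%N -> exists e : 'I_m -> V, (forall a, S (e a)) /\
    forall a b, q (e a) (e b) = (a == b)%:R by exact: main.
  elim: m => [_|m IH mn].
    by exists (fun=> 0); split=> -[].
  have [e [Se e_orth]] := IH (ltnW mn).
  have mV : (m < \dim {:V})%N by rewrite dimV.
  have [x [Sx qx xe]] := orthonormal_step qC Sreal qreal qpos Se e_orth mV.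
  exists (fun i => oapp e x (unlift ord_max i)); split=> [a|a b].
    by case: unliftP => [j _|_]; [exact: Se|exact: Sx].
  case: (unliftP ord_max a) => [a' ->|->]; case: (unliftP ord_max b) => [b' ->|->].
  - by rewrite /= (inj_eq (@lift_inj _ _)).
  - by rewrite /= qC xe eq_sym (negPf (neq_lift _ _)).
  - by rewrite /= xe (negPf (neq_lift _ _)).
  - by rewrite /= qx eqxx.
exists e; split=> //.
pose t := [tuple e a | a < n]; have tE (a : 'I_n) : t`_a = e a.
  by rewrite -(tnth_nth 0 t) tnth_mktuple.
have t_free : free t.
  apply/freeP => c c0 a; have : q (\sum_(i < n) c i *: t`_i) (e a) = 0.
    by rewrite c0 linear0l.
  rewrite linear_sumlz (bigD1 a) //= linearZl_LR /= tE e_orth eqxx mulr1.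
  rewrite big1 ?addr0 // => b /negPf ba.
  by rewrite linearZl_LR /= tE e_orth ba mulr0.
have t_basis : basis_of {:V} t.
  by rewrite basisEfree t_free subvf size_tuple dimV leqnn.
have eE v : v = \sum_a coord t a v *: e a.
  by rewrite {1}(coord_basis t_basis (memvf v)); apply: eq_bigr => a _; rewrite tE.
move=> v; rewrite {1}[v]eE; apply: eq_bigr => a _; congr (_ *: _).
rewrite [in RHS](eE v) linear_sumlz (bigD1 a) //= linearZl_LR /= e_orth eqxx mulr1.
by rewrite big1 ?addr0 // => b /negPf ba; rewrite linearZl_LR /= e_orth ba mulr0.
Qed.
End OrthonormalBasis.

(** * A basis of the tensor power *)

Section TensorBasis.
Variables (K : numClosedFieldType) (V W : vectType K) (n k : nat).
Variables (q : {biscalar V}) (tens : ('I_k.+1 -> V) -> W) (qF : {biscalar W}).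
Variable e : 'I_n.+1 -> V.
Hypothesis e_orth : forall a b, q (e a) (e b) = (a == b)%:R.
Hypothesis e_span : forall v, v = \sum_a q v (e a) *: e a.
Hypothesis tensP : tensor_power tens.
Hypothesis hqF : induced_form tens q qF.
Local Notation index := {ffun 'I_k.+1 -> 'I_n.+1}.
Local Notation E := (tens_basis tens e).

(** Slots are relaxed one at a time from basis vectors to arbitrary ones, by linearity in that slot;
    in [main] the first [m] slots are arbitrary. *)
Lemma multilinear_memv (U : {vspace W}) : multilinear tens ->
  (forall I : index, E I \in U) -> forall x, tens x \in U.
Proof.
move=> tens_lin EU.
suff main m : (m <= k.+1)%N -> forall x : 'I_k.+1 -> V,
    (forall j : 'I_k.+1, (m <= j)%N -> exists a, x j = e a) -> tens x \in U.
  by move=> x; apply: (main k.+1) => // j; rewrite leqNgt ltn_ord.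
elim: m => [_ x xe|m IH mk x xe].
  have [I xI] := choice (fun j => xe j isT).
  rewrite (_ : x = fun j => e ([ffun j => I j] j)); first exact: EU.
  by apply/funext => j; rewrite ffunE.
pose j0 := Ordinal mk; pose f y := tens [eta x with j0 |-> y].
have -> : tens x = f (x j0).
  by congr tens; apply/funext => j /=; case: eqP => [->|].
have f_lin c y z : f (c *: y + z) = c *: f y + f z by exact: tens_lin.
rewrite [x j0]e_span; elim/big_rec: _ => [|a v _ fv].
  have := f_lin (-1) 0 0; rewrite scaler0 addr0 scaleN1r addNr => ->; exact: mem0v.
rewrite f_lin memvD ?memvZ //; apply: (IH (ltnW mk)) => j mj /=.
case: eqP => [_|/eqP jj0]; first by exists a.
by apply: xe; rewrite ltn_neqAle mj andbT; apply: contra_neq jj0 => mj'; apply/val_inj.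
Qed.

(* Both the identity and the projection onto the span of the [E I] factor
   [tens] through itself, so they agree. *)
Lemma tens_basis_span T : T = \sum_I tau tens qF e I T *: E I.
Proof.
have [tens_lin tens_univ] := tensP.
pose s := [tuple E (enum_val i) | i < #|{: index}|].
have EU I : E I \in <<s>>%VS.
  by apply/memv_span/tnthP; exists (enum_rank I); rewrite tnth_mktuple enum_rankK.
have [g [_ g_uniq]] := tens_univ W tens tens_lin.
have g1 : g = \1%VF by apply: g_uniq => x; rewrite id_lfunE.
have gU : g = projv <<s>>%VS.
  by apply: g_uniq => x; rewrite projv_id // multilinear_memv.
have TU : T \in <<s>>%VS by rewrite -[T]id_lfunE -g1 gU memv_proj.
have [c cE] : exists c : index -> K, T = \sum_I c I *: E I.
  exists (fun I => coord s (enum_rank I) T); rewrite {1}(coord_span TU).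
  rewrite (reindex (@enum_rank _)) /=; last by exists enum_val => i _; rewrite ?enum_rankK ?enum_valK.
  by apply: eq_bigr => I _; rewrite -(tnth_nth 0 s) tnth_mktuple enum_rankK.
rewrite [in LHS]cE; apply: eq_bigr => I _; congr (_ *: _).
by rewrite cE (tauE e_orth hqF).
Qed.
End TensorBasis.

Theorem theorem40 (R : realType) (n k : nat) (V W : vectType R[i])
    (q : {biscalar V}) (tens : ('I_k -> V) -> W) (qF : {biscalar W})
    (n_gt0 : (0 < n)%N) (k_gt0 : (1 <= k)%N)
    (dimV : \dim {:V} = n)
    (hq : complexified_positive_definite q)
    (htens : tensor_power tens)
    (hqF : induced_form tens q qF) :
  irreducible (kalman_nor tens q qF) /\
  has_codim (kalman_nor tens q qF) ((k - 1) * (n - 1)).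
Proof.
case: n n_gt0 dimV => // n _ dimV; case: k tens k_gt0 htens hqF => // k tens _ htens hqF.
have [e [e_orth e_span]] := orthonormal_basis dimV hq.
rewrite !subn1 /=; apply: (kalman_irreducible_codim hq.1 e_orth e_span) => //.
exact: (tens_basis_span e_orth e_span htens hqF).
Qed.
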